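(* Let $\Omega\subset\mathbb{H}$ be a slice contractible circular domain. Given $a_0,a_1\in\mathcal{R}_{\mathbb{R}}(\Omega)$ such that $a_0^2+a_1^2\equiv1$, there exists $\gamma\in\mathcal{R}_{\mathbb{R}}(\Omega)$ such that $\cos_*(\gamma)=a_0$ and $\sin_*(\gamma)=a_1$. Moreover: (a) if $\Omega$ is a slice domain and $\tilde\gamma\in\mathcal{R}(\Omega)$ also satisfies $\cos_*(\tilde\gamma)=a_0$ and $\sin_*(\tilde\gamma)=a_1$, then there exists $k\in\mathbb{Z}$ such that $\tilde\gamma\equiv\gamma+2k\pi$; (b) if $\Omega$ is a product domain and $\tilde\gamma\in\mathcal{R}_{\mathbb{R}}(\Omega)$ also satisfies $\cos_*(\tilde\gamma)=a_0$ and $\sin_*(\tilde\gamma)=a_1$, then there exists $k\in\mathbb{Z}$ such that $\tilde\gamma\equiv\gamma+2k\pi$.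
   Context: $\mathbb{H}$ is the algebra of quaternions; $q=q_0+q_v$ with $q_0$ real and $q_v$ purely imaginary, $\mathbb{S}=\{I\in\mathbb{H}: I^2=-1\}$, $\mathbb{C}_I=\mathbb{R}+\mathbb{R}I$, $\mathbb{C}_I^+=\{\alpha+I\beta:\beta\ge0\}$, $\mathbb{S}_q=\{q_0+\|q_v\|J: J\in\mathbb{S}\}$, $\Omega_I=\Omega\cap\mathbb{C}_I$, $\Omega_I^+=\Omega\cap\mathbb{C}_I^+$. A domain (nonempty connected open set) $\Omega\subset\mathbb{H}$ is circular if $\mathbb{S}_q\subset\Omega$ for all $q\in\Omega$; it is a slice domain if $\Omega\cap\mathbb{R}\neq\emptyset$ and a product domain if $\Omega\cap\mathbb{R}=\emptyset$. It is slice contractible if, for some (equivalently any) $I\in\mathbb{S}$, $\Omega_I$ is a simply connected domain when $\Omega$ is slice, respectively $\Omega_I^+$ is a simply connected domain when $\Omega$ is product. A function $f:\Omega\to\mathbb{H}$ is slice regular if $f(\alpha+I\beta)=F_0(\alpha+\sqrt{-1}\beta)+I F_1(\alpha+\sqrt{-1}\beta)$ for all $I\in\mathbb{S}$ and $\alpha,\beta\in\mathbb{R}$ with $\alpha+I\beta\in\Omega$, where $F_0,F_1:\{\alpha+\sqrt{-1}\beta:\alpha+I\beta\in\Omega\}\to\mathbb{H}$ are $C^1$, $F_0(\bar z)=F_0(z)$, $F_1(\bar z)=-F_1(z)$ and $\partial_\alpha F_0=\partial_\beta F_1$, $\partial_\beta F_0=-\partial_\alpha F_1$. $\mathcal{R}(\Omega)$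 is the set of slice regular functions; $\mathcal{R}_{\mathbb{R}}(\Omega)$ is the subset of slice preserving ones, i.e. those with $f(\Omega_I)\subset\mathbb{C}_I$ for all $I\in\mathbb{S}$. The $*$-product is $(f*g)(q)=0$ if $f(q)=0$, and $(f*g)(q)=f(q)\,g(f(q)^{-1}qf(q))$ otherwise (it is the pointwise product if $f$ is slice preserving), and $f^{*n}$ is the $n$-th $*$-power. $\cos_*(f)=\sum_{n\ge0}\frac{(-1)^nf^{*(2n)}}{(2n)!}$ and $\sin_*(f)=\sum_{n\ge0}\frac{(-1)^nf^{*(2n+1)}}{(2n+1)!}$. *)

(* Defs.v *)
From HB Require Import structures.
From mathcomp Require Import all_boot all_order all_algebra.
From mathcomp Require Import ring lra.
From mathcomp Require Import all_classical all_reals all_analysis.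
Set Implicit Arguments.
Unset Strict Implicit.
Unset Printing Implicit Defensive.
Import Order.TTheory GRing.Theory Num.Theory.
Import numFieldNormedType.Exports.
Local Open Scope classical_set_scope.
Local Open Scope ring_scope.

(* The row (a, b, c, d) stands for a + b i + c j + d k.  The R-module structure
   and the topology are those of R^4; in particular [`|q|] is the sup norm, the
   Euclidean one being [qnorm] below. *)
Definition quat (R : realType) : Type := 'rV[R]_4.

HB.instance Definition _ (R : realType) :=
  NormedModule.copy (quat R) 'rV[R]_4.
HB.instance Definition _ (R : realType) := Complete.copy (quat R) 'rV[R]_4.

Definition Quat (R : realType) (a b c d : R) : quat R :=
  \row_(i < 4) [:: a; b; c; d]`_i.
Definition qre (R : realType) (q : quat R) : R := (q : 'rV_4) 0 0.
Definition qi (R : realType) (q : quat R) : R := (q : 'rV_4) 0 1.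
Definition qj (R : realType) (q : quat R) : R := (q : 'rV_4) 0 2.
Definition qk (R : realType) (q : quat R) : R := (q : 'rV_4) 0 3.

Definition qone (R : realType) : quat R := Quat 1 0 0 0.

Definition qmul (R : realType) (p q : quat R) : quat R :=
  Quat (qre p * qre q - qi p * qi q - qj p * qj q - qk p * qk q)
       (qre p * qi q + qi p * qre q + qj p * qk q - qk p * qj q)
       (qre p * qj q - qi p * qk q + qj p * qre q + qk p * qi q)
       (qre p * qk q + qi p * qj q - qj p * qi q + qk p * qre q).

Lemma quat_eqP (R : realType) (p q : quat R) :
  qre p = qre q -> qi p = qi q -> qj p = qj q -> qk p = qk q -> p = q.
Proof.
move=> h0 h1 h2 h3; apply/rowP => -[[|[|[|[|//]]]] i4].
- by have -> : Ordinal i4 = 0 by apply/val_inj.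
- by have -> : Ordinal i4 = 1 by apply/val_inj.
- by have -> : Ordinal i4 = 2 by apply/val_inj.
- by have -> : Ordinal i4 = 3 by apply/val_inj.
Qed.

Lemma qcoordD (R : realType) (p q : quat R) :
  ((qre (p + q) = qre p + qre q)%R * (qi (p + q) = qi p + qi q)%R *
   (qj (p + q) = qj p + qj q)%R * (qk (p + q) = qk p + qk q)%R)%type.
Proof. by rewrite /qre /qi /qj /qk !mxE. Qed.

Lemma qcoordZ (R : realType) (a : R) (q : quat R) :
  ((qre (a *: q) = a * qre q)%R * (qi (a *: q) = a * qi q)%R *
   (qj (a *: q) = a * qj q)%R * (qk (a *: q) = a * qk q)%R)%type.
Proof. by rewrite /qre /qi /qj /qk !mxE. Qed.

Lemma qcoord0 (R : realType) :
  ((qre (0 : quat R) = 0)%R * (qi (0 : quat R) = 0)%R *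
   (qj (0 : quat R) = 0)%R * (qk (0 : quat R) = 0)%R)%type.
Proof. by rewrite /qre /qi /qj /qk !mxE. Qed.

Lemma qcoordE (R : realType) (a b c d : R) :
  ((qre (Quat a b c d) = a)%R * (qi (Quat a b c d) = b)%R *
   (qj (Quat a b c d) = c)%R * (qk (Quat a b c d) = d)%R)%type.
Proof. by rewrite /qre /qi /qj /qk !mxE. Qed.

Lemma qmulA (R : realType) : associative (@qmul R).
Proof. by move=> p q r; apply: quat_eqP; rewrite /qmul !qcoordE; ring. Qed.

Lemma qmul1l (R : realType) : left_id (qone R) (@qmul R).
Proof. by move=> p; apply: quat_eqP; rewrite /qmul /qone !qcoordE; ring. Qed.

Lemma qmul1r (R : realType) : right_id (qone R) (@qmul R).
Proof. by move=> p; apply: quat_eqP; rewrite /qmul /qone !qcoordE; ring. Qed.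

Lemma qmulDl (R : realType) : left_distributive (@qmul R) +%R.
Proof.
by move=> p q r; apply: quat_eqP; rewrite qcoordD /qmul !qcoordD !qcoordE; ring.
Qed.

Lemma qmulDr (R : realType) : right_distributive (@qmul R) +%R.
Proof.
by move=> p q r; apply: quat_eqP; rewrite qcoordD /qmul !qcoordD !qcoordE; ring.
Qed.

Lemma qone_neq0 (R : realType) : qone R != 0.
Proof. apply/eqP => /(congr1 (@qre R)); rewrite qcoordE qcoord0 => /eqP.
by rewrite oner_eq0. Qed.

HB.instance Definition _ (R : realType) := GRing.Zmodule_isNzRing.Build (quat R)
  (@qmulA R) (@qmul1l R) (@qmul1r R) (@qmulDl R) (@qmulDr R) (qone_neq0 R).

Lemma qmulE (R : realType) (p q : quat R) : p * q = qmul p q.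
Proof. by []. Qed.

Lemma qoneE (R : realType) : 1 = qone R.
Proof. by []. Qed.

Lemma qscalerAl (R : realType) (a : R) (p q : quat R) :
  a *: (p * q) = a *: p * q.
Proof.
by rewrite !(qmulE _ q); apply: quat_eqP; rewrite qcoordZ /qmul !qcoordZ !qcoordE;
  ring.
Qed.

HB.instance Definition _ (R : realType) :=
  GRing.Lmodule_isLalgebra.Build R (quat R) (@qscalerAl R).

Lemma qscalerAr (R : realType) (a : R) (p q : quat R) :
  a *: (p * q) = p * (a *: q).
Proof.
by rewrite !(qmulE p); apply: quat_eqP; rewrite qcoordZ /qmul !qcoordZ !qcoordE;
  ring.
Qed.

HB.instance Definition _ (R : realType) :=
  GRing.Lalgebra_isAlgebra.Build R (quat R) (@qscalerAr R).

Definition qnorm2 (R : realType) (q : quat R) : R :=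
  qre q ^+ 2 + qi q ^+ 2 + qj q ^+ 2 + qk q ^+ 2.

Definition qconj (R : realType) (q : quat R) : quat R :=
  Quat (qre q) (- qi q) (- qj q) (- qk q).

Definition qinv (R : realType) (q : quat R) : quat R :=
  (qnorm2 q)^-1 *: qconj q.

Lemma qnorm2_eq0 (R : realType) (q : quat R) : (qnorm2 q == 0) = (q == 0).
Proof.
apply/eqP/eqP => [|->]; last by rewrite /qnorm2 !qcoord0 !expr0n /= !addr0.
move=> h; have := (sqr_ge0 (qre q), sqr_ge0 (qi q), sqr_ge0 (qj q),
  sqr_ge0 (qk q)).
move=> -[[[h1 h2] h3] h4]; rewrite /qnorm2 in h.
by apply: quat_eqP; rewrite qcoord0; apply/eqP; rewrite -sqrf_eq0;
  apply/eqP; lra.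
Qed.

Lemma qconjMl (R : realType) (q : quat R) : qconj q * q = (qnorm2 q)%:A.
Proof.
by rewrite qmulE qoneE; apply: quat_eqP; rewrite qcoordZ /qmul /qone /qconj
  !qcoordE /qnorm2; ring.
Qed.

Lemma qconjMr (R : realType) (q : quat R) : q * qconj q = (qnorm2 q)%:A.
Proof.
by rewrite qmulE qoneE; apply: quat_eqP; rewrite qcoordZ /qmul /qone /qconj
  !qcoordE /qnorm2; ring.
Qed.

Lemma qmulVq (R : realType) :
  {in predC1 0, left_inverse 1 (@qinv R) *%R}.
Proof.
move=> q; rewrite inE -qnorm2_eq0 => q0.
by rewrite /qinv -scalerAl qconjMl scalerA mulVf// scale1r.
Qed.

Lemma qmulqV (R : realType) :
  {in predC1 0, right_inverse 1 (@qinv R) *%R}.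
Proof.
move=> q; rewrite inE -qnorm2_eq0 => q0.
by rewrite /qinv -scalerAr qconjMr scalerA mulVf// scale1r.
Qed.

Lemma qunitP (R : realType) (p q : quat R) :
  q * p = 1 /\ p * q = 1 -> predC1 0 p.
Proof.
by move=> [qp _] /=; apply: contra_eq_neq qp => ->; rewrite mulr0 eq_sym oner_neq0.
Qed.

Lemma qinv_out (R : realType) : {in [predC predC1 0], @qinv R =1 id}.
Proof.
move=> q; rewrite !inE negbK => /eqP ->.
by apply: quat_eqP; rewrite /qinv qcoordZ /qconj !qcoordE !qcoord0
  ?oppr0 mulr0.
Qed.

HB.instance Definition _ (R : realType) := GRing.NzRing_hasMulInverse.Build
  (quat R) (@qmulVq R) (@qmulqV R) (@qunitP R) (@qinv_out R).

Definition qnorm (R : realType) (q : quat R) : R := Num.sqrt (qnorm2 q).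

Definition qvec (R : realType) (q : quat R) : quat R := q - (qre q)%:A.

Definition imag_sphere (R : realType) : set (quat R) := [set I | I ^+ 2 = -1].

(* alpha + I beta, for z = (alpha, beta) in the plane R^2 = C; it identifies
   the slice C_I with C, so that subsets of C_I are described as subsets of
   R^2. *)
Definition slice_pt (R : realType) (I : quat R) (z : R * R) : quat R :=
  z.1%:A + z.2 *: I.

Definition C_slice (R : realType) (I : quat R) : set (quat R) :=
  range (slice_pt I).

Definition real_line (R : realType) : set (quat R) :=
  range (fun x : R => x%:A : quat R).

Definition qsphere (R : realType) (q : quat R) : set (quat R) :=
  [set (qre q)%:A + qnorm (qvec q) *: J | J in @imag_sphere R].

Definition domain (T : topologicalType) (A : set T) : Prop :=
  [/\ A !=set0, open A & connected A].

Definition circular_domain (R : realType) (Omega : set (quat R)) : Prop :=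
  domain Omega /\ forall q, Omega q -> qsphere q `<=` Omega.

Definition slice_domain (R : realType) (Omega : set (quat R)) : Prop :=
  Omega `&` @real_line R !=set0.

Definition product_domain (R : realType) (Omega : set (quat R)) : Prop :=
  Omega `&` @real_line R = set0.

Definition path_connected (R : realType) (T : topologicalType) (A : set T) :
    Prop :=
  forall x y, A x -> A y -> exists c : R -> T,
    [/\ {within `[0, 1], continuous c}, forall t, t \in `[0, 1] -> A (c t),
        c 0 = x & c 1 = y].

Definition loops_contractible (R : realType) (T : topologicalType) (A : set T) :
    Prop :=
  forall c : R -> T,
    {within `[0, 1], continuous c} -> (forall t, t \in `[0, 1] -> A (c t)) ->
    c 0 = c 1 ->
  exists H : R * R -> T,
    [/\ {within [set` `[0, 1]] `*` [set` `[0, 1]], continuous H},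
        forall s t, s \in `[0, 1] -> t \in `[0, 1] -> A (H (s, t)),
        forall t, t \in `[0, 1] -> H (0, t) = c t,
        forall t, t \in `[0, 1] -> H (1, t) = c 0 &
        forall s, s \in `[0, 1] -> H (s, 0) = c 0 /\ H (s, 1) = c 0].

Definition simply_connected_domain (R : realType) (A : set (R * R)) : Prop :=
  [/\ domain A, path_connected R A & loops_contractible R A].

Definition slice_of (R : realType) (Omega : set (quat R)) (I : quat R) :
    set (R * R) :=
  slice_pt I @^-1` Omega.

Definition half_slice_of (R : realType) (Omega : set (quat R)) (I : quat R) :
    set (R * R) :=
  slice_of Omega I `&` [set z | 0 <= z.2].

Definition slice_contractible (R : realType) (Omega : set (quat R)) : Prop :=
  exists2 I, @imag_sphere R I &
    (slice_domain Omega -> simply_connected_domain (slice_of Omega I)) /\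
    (product_domain Omega -> simply_connected_domain (half_slice_of Omega I)).

Definition plane_of (R : realType) (Omega : set (quat R)) : set (R * R) :=
  \bigcup_(I in @imag_sphere R) slice_of Omega I.

(* Meant for open D, where the directional derivatives in the plane only depend
   on the values of F on D. *)
Definition C1_on (R : realType) (D : set (R * R)) (F : R * R -> quat R) :
    Prop :=
  forall z, D z ->
    [/\ derivable F z (1, 0), derivable F z (0, 1),
        {for z, continuous ('D_(1, 0) F)} & {for z, continuous ('D_(0, 1) F)}].

(* Functions on Omega are total functions of which only the restriction to
   Omega matters. *)
Definition slice_regular (R : realType) (Omega : set (quat R))
    (f : quat R -> quat R) : Prop :=
  exists F0 F1 : R * R -> quat R,
    [/\ C1_on (plane_of Omega) F0, C1_on (plane_of Omega) F1,
        forall z, plane_of Omega z ->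
          F0 (z.1, - z.2) = F0 z /\ F1 (z.1, - z.2) = - F1 z,
        forall z, plane_of Omega z ->
          'D_(1, 0) F0 z = 'D_(0, 1) F1 z /\
          'D_(0, 1) F0 z = - 'D_(1, 0) F1 z &
        forall I z, imag_sphere I -> Omega (slice_pt I z) ->
          f (slice_pt I z) = F0 z + I * F1 z].

Definition slice_preserving_regular (R : realType) (Omega : set (quat R))
    (f : quat R -> quat R) : Prop :=
  slice_regular Omega f /\
  forall I, imag_sphere I -> f @` (Omega `&` C_slice I) `<=` C_slice I.

Definition star (R : realType) (f g : quat R -> quat R) : quat R -> quat R :=
  fun q => if f q == 0 then 0 else f q * g ((f q)^-1 * q * f q).

Definition star_pow (R : realType) (f : quat R -> quat R) (n : nat) :
    quat R -> quat R :=
  iter n (star f) (fun=> 1).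

(* The series converge at every point of Omega when f is slice regular on
   Omega. *)
Definition cos_star (R : realType) (f : quat R -> quat R) (q : quat R) :
    quat R :=
  limn (series (fun n => ((-1) ^+ n / (2 * n)%N`!%:R) *: star_pow f (2 * n)%N q)).

Definition sin_star (R : realType) (f : quat R -> quat R) (q : quat R) :
    quat R :=
  limn (series (fun n =>
    ((-1) ^+ n / (2 * n)%N.+1`!%:R) *: star_pow f (2 * n)%N.+1 q)).

(* Main.v *)
Require Import Defs.
From mathcomp Require Import all_boot all_order all_algebra.
From mathcomp Require Import ring lra.
From mathcomp Require Import all_classical all_reals all_analysis.
From mathcomp Require complex.
Set Implicit Arguments.
Unset Strict Implicit.
Unset Printing Implicit Defensive.
Import Order.TTheory GRing.Theory Num.Theory.
Import numFieldNormedType.Exports.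
Local Open Scope classical_set_scope.
Local Open Scope ring_scope.

(** A slice regular function is a pair of maps F_0, F_1 from a plane domain D
    to the quaternions, that is, one map F = F_0 + i F_1 to the complexified
    algebra, evaluated on the slice of I by sending i to I.  Evaluation turns the
    star product into the pointwise product of that algebra (star_stem), and
    slice preserving functions are those with F_0, F_1 real, so that F is then an
    ordinary holomorphic function with F(conj z) = conj F(z).

    Existence.  The stem functions alpha_0, alpha_1 of a_0, a_1 satisfy
    alpha_0^2 + alpha_1^2 = 1, so h = alpha_0 + i alpha_1 has the inverse
    alpha_0 - i alpha_1, and the problem is to solve exp(i G) = h.  The imaginary
    part of G is - ln |h|; the real part is a continuous choice of the angle of
    h / |h|, which exists on a simply connected domain by lifting paths and
    contracting loops (angle_lift).  Continuity of the angle suffices for G to be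
    C^1 and to satisfy the Cauchy-Riemann equations (arg_derive).  The symmetry of
    the stem functions gives h(conj z) = 1 / conj (h z), so h / |h| takes the same
    value at z and at conj z.  An angle need therefore only be chosen on the closed
    upper half of D, and can be extended evenly: this treats slice domains, where
    D is simply connected, and product domains, where its upper half is, alike.

    Uniqueness among real stem functions.  The cosine and the sine determine
    exp(i G), hence the imaginary part of G, and its real part up to 2 k pi with k
    constant by connectedness (lift_unique).

    Uniqueness among all slice regular functions, on a slice domain.  Write
    F = f_0 + f_v with f_0 complex and f_v a complexified imaginary quaternion,
    so f_v^2 = - N with N complex.  If mu^2 = - N, then the star cosine and sine
    have vector parts proportional to f_v, with factors the divided differences
    of cos and sin between f_0 + mu and f_0 - mu (cos_sin_star_stem).  These factors
    vanish together only if mu is a nonzero multiple of pi; since a_0 and a_1 have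
    no vector part, at each point either f_v = 0 or Re N <= - pi^2
    (scalar_or_far).  At a real point F_1 = 0, so N >= 0; as Re N is continuous
    and D is connected, f_v = 0 everywhere, and F has real components. *)

(** * Real angles *)

Section angles.
Variable R : realType.

Lemma cos_eq1 (x : R) : 0 <= x < 2 * pi -> cos x = 1 -> x = 0.
Proof.
move=> /andP[x0 x2] cx; apply/eqP; case: (ltgtP x 0) x0 => // x0 _.
have h : 0 < x / 2 < pi by apply/andP; split; lra.
have := sin_gt0_pi h.
have : cos (x / 2 *+ 2) = 1 by rewrite -mulr_natr divfK.
rewrite cos_mulr2n cos2sin2 => e s0.
have /eqP : sin (x / 2) ^+ 2 = 0 by lra.
by rewrite sqrf_eq0 gt_eqF.
Qed.

Lemma cosD2pi_int (x : R) (k : int) : cos (x + 2 * k%:~R * pi) = cos x.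
Proof.
have h (n : nat) (y : R) : cos (y + 2 * n%:R * pi) = cos y.
  rewrite (_ : 2 * n%:R * pi = (pi *+ 2) *+ n); first exact: (periodicn (@cosD2pi R)).
  by rewrite -mulrnA -(mulr_natr pi) natrM; ring.
case: k => n; first by rewrite -pmulrn h.
rewrite NegzE mulrNz -pmulrn -(h n.+1 (_ + _)); congr cos; ring.
Qed.

Lemma sinD2pi_int (x : R) (k : int) : sin (x + 2 * k%:~R * pi) = sin x.
Proof.
by rewrite -!cosBpihalf addrAC cosD2pi_int.
Qed.

(** Reduce the difference of the angles to [0, 2 pi[ by a floor: its cosine is 1. *)
Lemma cos_sin_inj (a b : R) : cos a = cos b -> sin a = sin b ->
  exists k : int, a = b + 2 * k%:~R * pi.
Proof.
move=> cab sab.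
have c1 : cos (a - b) = 1.
  by rewrite cosB cab sab -!expr2 cos2Dsin2.
have pi0 := pi_gt0 R.
pose k := Num.floor ((a - b) / (2 * pi)).
exists k.
have [h1 h2] : k%:~R <= (a - b) / (2 * pi) /\ (a - b) / (2 * pi) < (k + 1)%:~R.
  by split; [exact: floor_le | exact: floorD1_gt].
have p2 : 0 < 2 * pi :> R by lra.
rewrite ler_pdivlMr// in h1; rewrite ltr_pdivrMr// intrD mulrDl in h2.
have d0 : a - b + 2 * (- k)%:~R * pi = 0.
  apply: cos_eq1; last by rewrite cosD2pi_int.
  rewrite intrN; apply/andP; split; lra.
by rewrite intrN in d0; lra.
Qed.

Lemma polar_angle (c s : R) : c ^+ 2 + s ^+ 2 = 1 ->
  exists a, cos a = c /\ sin a = s.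
Proof.
move=> cs.
have cb : -1 <= c <= 1.
  rewrite -ler_norml -(@ler_pXn2r _ 2)// ?nnegrE//.
  by rewrite real_normK ?num_real// expr1n; have := sqr_ge0 s; lra.
have e : Num.sqrt (1 - c ^+ 2) = `|s| by rewrite -sqrtr_sqr; congr Num.sqrt; lra.
have ck : cos (acos c) = c by apply: acosK.
have [s0|s0] := leP 0 s.
  by exists (acos c); rewrite ck sin_acos// e ger0_norm.
by exists (- acos c); rewrite cosN sinN ck sin_acos// e ltr0_norm// opprK.
Qed.

Lemma asin0 : asin 0 = 0 :> R.
Proof.
rewrite -[in LHS](@sin0 R) sinK// in_itv /=; have := pi_gt0 R => h.
by apply/andP; split; lra.
Qed.

Lemma asin_step_lt (c s c' s' : R) :
  c ^+ 2 + s ^+ 2 = 1 -> c' ^+ 2 + s' ^+ 2 = 1 -> 0 < c * c' + s * s' ->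
  -1 < s' * c - c' * s < 1.
Proof.
move=> h h' p; rewrite -ltr_norml -(@ltr_pXn2r _ 2)// ?nnegrE//.
rewrite real_normK ?num_real// expr1n.
have -> : (s' * c - c' * s) ^+ 2 = 1 - (c * c' + s * s') ^+ 2.
  by rewrite -[1](mul1r (1 : R)) -{1}h -h'; ring.
by rewrite ltrBlDr ltrDl exprn_gt0.
Qed.

(** The angle from the unit vector (c, s) to (c', s') is the arcsine of their
    cross product as long as their scalar product is positive. *)
Lemma asin_step (a c s c' s' : R) :
  c ^+ 2 + s ^+ 2 = 1 -> c' ^+ 2 + s' ^+ 2 = 1 -> 0 < c * c' + s * s' ->
  cos a = c -> sin a = s ->
  cos (a + asin (s' * c - c' * s)) = c' /\ sin (a + asin (s' * c - c' * s)) = s'.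
Proof.
move=> h h' p ca sa; have /andP[l1 l2] := asin_step_lt h h' p.
have b : -1 <= s' * c - c' * s <= 1 by rewrite !ltW.
have cd : cos (asin (s' * c - c' * s)) = c * c' + s * s'.
  rewrite cos_asin// -[RHS]ger0_norm ?ltW// -sqrtr_sqr; congr Num.sqrt.
  by rewrite -[1](mul1r (1 : R)) -{1}h -h'; ring.
have sd : sin (asin (s' * c - c' * s)) = s' * c - c' * s by apply: asinK.
rewrite cosD sinD cd sd ca sa; split.
  by rewrite -[RHS]mul1r -h; ring.
by rewrite -[RHS]mul1r -h; ring.
Qed.

End angles.

(** * Continuous angles on simply connected domains *)

Section lifting.
Variable R : realType.

(** Two continuous angles of the same map differ by a function with values in
    2 pi Z; on a connected set its image is an interval, and the midpoint of two
    consecutive values is excluded because the cosine is -1 there. *)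
Lemma lift_unique (T : topologicalType) (E : set T) (f g : T -> R) :
  connected E ->
  (forall x, E x -> {for x, continuous f}) ->
  (forall x, E x -> {for x, continuous g}) ->
  (forall x, E x -> cos (f x) = cos (g x)) ->
  (forall x, E x -> sin (f x) = sin (g x)) ->
  forall x y, E x -> E y -> f x - g x = f y - g y.
Proof.
move=> cE cf cg ec es.
pose d x := f x - g x.
have cd : {within E, continuous d}.
  apply: continuous_in_subspaceT => x; rewrite inE => Ex.
  by apply: continuousB; [exact: cf|exact: cg].
have /connected_intervalP itv := connected_continuous_connected cE cd.
have dk x : E x -> exists k : int, d x = 2 * k%:~R * pi.
  move=> Ex; have [k e] := cos_sin_inj (ec _ Ex) (es _ Ex).
  by exists k; rewrite /d e; ring.
have key x y : E x -> E y -> ~ (d x < d y).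
  move=> Ex Ey xy.
  have [k kx] := dk _ Ex; have [l ly] := dk _ Ey.
  have pi0 := pi_gt0 R.
  have kl : (k + 1 <= l).
    rewrite lezD1 -(ltr_int R); move: xy; rewrite kx ly.
    by rewrite ltr_pM2r// ltr_pM2l.
  have kl' : (k%:~R + 1) * pi <= l%:~R * pi :> R.
    by rewrite ler_pM2r// -(intrD _ k 1) ler_int.
  have [z Ez ez] : (d @` E) (d x + pi).
    apply: (itv (d x) (d y)); [by exists x|by exists y|].
    by rewrite kx ly; apply/andP; split; lra.
  have [m mz] := dk _ Ez.
  have : cos (d x + pi) = 1.
    by rewrite -ez mz -[_ * pi]add0r cosD2pi_int cos0.
  rewrite cosDpi kx -[2 * _ * _]add0r cosD2pi_int cos0; lra.
move=> x y Ex Ey; apply/eqP; case: ltgtP => // h; exfalso.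
  exact: (key _ _ Ex Ey h).
exact: (key _ _ Ey Ex h).
Qed.

Definition square : set (R * R) := [set` `[0 : R, 1]] `*` [set` `[0 : R, 1]].

Lemma squareP (x : R * R) : square x <-> (0 <= x.1 <= 1) /\ (0 <= x.2 <= 1).
Proof. by rewrite /square /= !in_itv. Qed.

(** Uniform continuity on the compact square, in the only form in which it is
    used: nearby points have images less than a right angle apart. *)
Lemma square_uniform (C S : R * R -> R) :
  continuous C -> continuous S -> (forall x, C x ^+ 2 + S x ^+ 2 = 1) ->
  exists n : nat, forall x y : R * R, square x -> `|x - y| <= n.+1%:R^-1 ->
    0 < C x * C y + S x * S y.
Proof.
move=> cC cS CS.
have : compact square by apply: compact_setX; exact: segment_compact.
move=> /compact_near_coveringP /(_ nat \oo
  (fun n x => forall y, `|x - y| <= n.+1%:R^-1 -> 0 < C x * C y + S x * S y)) h.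
have [|N _ HN] := h; last by exists N => x y Kx; apply: (HN N) => //=.
move=> x Kx.
have /cvgrPdist_lt/(_ (1/4)) := cC x; have /cvgrPdist_lt/(_ (1/4)) := cS x.
have q4 : (0 : R) < 1 / 4 by lra.
move=> /(_ q4) nS /(_ q4) nC.
have [d /= d0 hd] := iffLR (nbhs_ballP x _) (filterI nS nC).
have d20 : 0 < d / 2 by lra.
near=> x' n => y xy.
have x'x : ball x (d / 2) x' by near: x'; exact: nbhsx_ballx.
have nd : n.+1%:R^-1 < d / 2.
  by near: n; exact: near_infty_natSinv_lt (PosNum d20).
have yx : ball x d y.
  rewrite [d](splitr d); apply: ball_triangle x'x _.
  rewrite -ball_normE /ball_ /=; exact: le_lt_trans xy nd.
have x'x' : ball x d x' by apply: le_ball x'x; lra.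
have [/= s1 c1] := hd _ x'x'; have [/= s2 c2] := hd _ yx.
have sq (a b c : R) : `|a - b| < 1 / 4 -> `|a - c| < 1 / 4 -> (b - c) ^+ 2 <= 1 / 4.
  move=> h1 h2; have : `|b - c| <= 1 / 2.
    rewrite -[b - c](subrKA a) distrC in h1 *.
    by apply: le_trans (ler_normD _ _) _; lra.
  move=> h3; rewrite -[(b - c) ^+ 2]real_normK ?num_real//.
  by have := normr_ge0 (b - c); nra.
have hS := sq _ _ _ s1 s2; have hC := sq _ _ _ c1 c2.
have := CS x'; have := CS y => e1 e2.
nra.
Unshelve. all: by end_near. Qed.

(** Along the segment from the origin to x, cut into n + 1 equal pieces, successive
    images are less than a right angle apart, so their angles add up through
    arcsines.  All points use the same n, hence the sum is continuous in x and no
    gluing is needed. *)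
Lemma square_lift (C S : R * R -> R) :
  continuous C -> continuous S -> (forall x, C x ^+ 2 + S x ^+ 2 = 1) ->
  exists f : R * R -> R, forall x, square x ->
    [/\ {for x, continuous f}, cos (f x) = C x & sin (f x) = S x].
Proof.
move=> cC cS CS.
have [n hn] := square_uniform cC cS CS.
have [a [ca sa]] := polar_angle (CS 0).
pose pt (k : nat) (x : R * R) : R * R := (k%:R / n.+1%:R) *: x.
pose F k x := asin (S (pt k.+1 x) * C (pt k x) - C (pt k.+1 x) * S (pt k x)).
pose f k x := a + \sum_(0 <= i < k) F i x.
have cpt k : continuous (pt k) by move=> x; exact: scaler_continuous.
have cCp k : continuous (C \o pt k).
  by move=> x; apply: continuous_comp; [exact: cpt|exact: cC].
have cSp k : continuous (S \o pt k).
  by move=> x; apply: continuous_comp; [exact: cpt|exact: cS].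
have ptK k x : (k <= n.+1)%N -> square x -> square (pt k x).
  move=> kn /squareP[/andP[a1 a2] /andP[b1 b2]]; apply/squareP => /=.
  have t0 : 0 <= k%:R / n.+1%:R :> R by rewrite divr_ge0.
  have t1 : k%:R / n.+1%:R <= 1 :> R by rewrite ler_pdivrMr// mul1r ler_nat.
  by split; apply/andP; split; solve [exact: mulr_ge0 | exact: mulr_ile1].
have pts k x : square x -> `|pt k x - pt k.+1 x| <= n.+1%:R^-1.
  move=> /squareP[/andP[a1 a2] /andP[b1 b2]].
  rewrite /pt -scalerBl -mulrBl -natr1 opprD addNKr normrZ mulN1r normrN.
  rewrite ger0_norm ?invr_ge0// ler_piMr ?invr_ge0//.
  by rewrite prod_normE ge_max !ger0_norm// a2 b2.
have main k : (k <= n.+1)%N -> forall x, square x ->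
    [/\ {for x, continuous (f k)}, cos (f k x) = C (pt k x) & sin (f k x) = S (pt k x)].
  elim: k => [_|k IH kn] x Kx.
    have -> : f 0%N = fun=> a by apply/funext => y; rewrite /f big_geq// addr0.
    by rewrite /pt mul0r scale0r; split => //; exact: cst_continuous.
  have [h1 h2 h3] := IH (ltnW kn) x Kx.
  have p := hn _ _ (ptK _ _ (ltnW kn) Kx) (pts k _ Kx).
  have -> : f k.+1 = fun y => f k y + F k y.
    by apply/funext => y; rewrite /f big_nat_recr//= addrA.
  have [e1 e2] := asin_step (CS _) (CS _) p h2 h3.
  split => //; apply: continuousD => //.
  apply: (@continuous_comp _ _ _
    (fun y => S (pt k.+1 y) * C (pt k y) - C (pt k.+1 y) * S (pt k y)) (@asin R)).
    by apply: continuousB; apply: continuousM; (exact: cCp || exact: cSp).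
  exact/continuous_asin/asin_step_lt.
exists (f n.+1) => x Kx.
have [] := main n.+1 (leqnn _) x Kx.
by rewrite /pt divff ?pnatr_eq0// scale1r.
Qed.

(** The retraction of the line onto [0, 1], in a form whose continuity is
    immediate; composing with it makes paths and homotopies total. *)
Definition clamp (t : R) : R := (`|t| - `|t - 1| + 1) / 2.

Lemma clamp_continuous : continuous clamp.
Proof.
move=> t; apply: cvgM; last exact: cvg_cst.
apply: cvgD; last exact: cvg_cst.
apply: cvgB; first exact: norm_continuous.
apply: (@continuous_comp _ _ _ (fun t : R => t - 1) (fun t => `|t|)).
  by apply: cvgB; [exact: cvg_id|exact: cvg_cst].
exact: norm_continuous.
Qed.

Lemma clamp_itv t : 0 <= clamp t <= 1.
Proof.
rewrite /clamp; have [t0|t0] := ler0P t; have [t1|t1] := ler0P (t - 1); apply/andP; split; lra.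
Qed.

Lemma clamp_in t : clamp t \in `[0, 1].
Proof. by rewrite in_itv /= clamp_itv. Qed.

Lemma clamp_id t : 0 <= t <= 1 -> clamp t = t.
Proof.
move=> /andP[t0 t1]; rewrite /clamp ger0_norm// ler0_norm; lra.
Qed.

Lemma clamp_le0 t : t <= 0 -> clamp t = 0.
Proof.
by move=> t0; rewrite /clamp !ler0_norm//; lra.
Qed.

Lemma clamp_ge1 t : 1 <= t -> clamp t = 1.
Proof.
by move=> t0; rewrite /clamp !ger0_norm//; lra.
Qed.

Lemma within_comp (T U V : topologicalType) (A : set U) (f : U -> V) (g : T -> U) :
  {within A, continuous f} -> continuous g -> (forall t, A (g t)) ->
  continuous (f \o g).
Proof.
move=> /subspace_continuousP cf cg gA t.
apply: (cvg_comp _ _ _ (cf _ (gA t))) => W /= h.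
have H : nbhs t (fun s => A (g s) -> W (g s)) := cg t _ h.
have : nbhs t (fun s => W (g s)) by apply: filterS H => s; apply.
by [].
Qed.

Lemma pair_continuous (T U V : topologicalType) (f : T -> U) (g : T -> V) (t : T) :
  {for t, continuous f} -> {for t, continuous g} ->
  {for t, continuous (fun t => (f t, g t))}.
Proof. by move=> cf cg; apply: (cvg_pair cf cg). Qed.

Section angle_lift.
Variables (D : set (R * R)) (C S : R * R -> R).
Hypotheses (cC : forall z, D z -> {for z, continuous C})
  (cS : forall z, D z -> {for z, continuous S})
  (CS : forall z, D z -> C z ^+ 2 + S z ^+ 2 = 1).

(** Everything is required on the whole line, so that paths can be composed with
    clamp and with affine maps without side conditions. *)
Definition pathlift (c : R -> R * R) (f : R -> R) :=
  [/\ continuous c, forall t, D (c t), continuous f,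
      forall t, cos (f t) = C (c t) & forall t, sin (f t) = S (c t)].

Lemma pathlift_exists c a : continuous c -> (forall t, D (c t)) ->
  cos a = C (c (clamp 0)) -> sin a = S (c (clamp 0)) ->
  exists f, pathlift (c \o clamp) f /\ f 0 = a.
Proof.
move=> cc cD ca sa.
pose c2 (x : R * R) := c (clamp x.1).
have cc' : continuous c2.
  move=> x; apply: (@continuous_comp _ _ _ fst (c \o clamp)); first exact: cvg_fst.
  by apply: continuous_comp; [exact: clamp_continuous|exact: cc].
have hC : continuous (C \o c2).
  by move=> x; apply: continuous_comp; [exact: cc'|apply: cC; exact: cD].
have hS : continuous (S \o c2).
  by move=> x; apply: continuous_comp; [exact: cc'|apply: cS; exact: cD].
have [F hF] := square_lift hC hS (fun x => CS (cD _)).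
have sq t : square (clamp t, 0).
  by apply/squareP => /=; rewrite clamp_itv lexx ler01.
have clampK t : clamp (clamp t) = clamp t by apply/clamp_id/clamp_itv.
have [h0 h1 h2] := hF _ (sq 0).
have [k ka] : exists k : int, a = F (clamp 0, 0) + 2 * k%:~R * pi.
  by apply: cos_sin_inj; rewrite ?h1 ?h2 /= /c2 /= clampK.
exists (fun t => F (clamp t, 0) + 2 * k%:~R * pi); split=> //.
split.
- by move=> t; apply: continuous_comp; [exact: clamp_continuous|exact: cc].
- by move=> t; apply: cD.
- move=> t; apply: cvgD; last exact: cvg_cst.
  have [h _ _] := hF _ (sq t).
  apply: (@continuous_comp _ _ _ (fun t => (clamp t, 0 : R)) F) => //.
  by apply: pair_continuous; [exact: clamp_continuous|exact: cvg_cst].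
- by move=> t; have [_ h _] := hF _ (sq t); rewrite cosD2pi_int h /= /c2 /= clampK.
- by move=> t; have [_ _ h] := hF _ (sq t); rewrite sinD2pi_int h /= /c2 /= clampK.
Qed.

(** Concatenation of paths; the first term is constant on the second half of
    [0, 1], the second one on the first half, and the constant c2 0 = c1 1 is
    counted twice. *)
Definition join_fun (V : zmodType) (c1 c2 : R -> V) (t : R) : V :=
  c1 (clamp (2 * t)) + c2 (clamp (2 * t - 1)) - c2 0.

Lemma join_fun_cases (V : zmodType) (c1 c2 : R -> V) t :
  c1 1 = c2 0 ->
  join_fun c1 c2 t = if t <= 1 / 2 then c1 (clamp (2 * t)) else c2 (clamp (2 * t - 1)).
Proof.
move=> e; rewrite /join_fun; case: ifP => h.
  by rewrite (@clamp_le0 (2 * t - 1)) ?addrK//; lra.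
rewrite (@clamp_ge1 (2 * t)); last by lra.
by rewrite e addrAC subrr add0r.
Qed.

Lemma join_fun_continuous (V : normedModType R) (c1 c2 : R -> V) :
  continuous c1 -> continuous c2 -> continuous (join_fun c1 c2).
Proof.
have lin (b : R) : continuous (fun t : R => clamp (2 * t - b)).
  move=> t; apply: (@continuous_comp _ _ _ (fun t : R => 2 * t - b) clamp);
    last exact: clamp_continuous.
  by apply: cvgB; [apply: cvgMl_tmp; exact: cvg_id|exact: cvg_cst].
move=> h1 h2 t; apply: cvgB; last exact: cvg_cst.
apply: cvgD.
  apply: (@continuous_comp _ _ _ (fun t : R => clamp (2 * t)) c1); last exact: h1.
  apply: (@continuous_comp _ _ _ (fun t : R => 2 * t) clamp); last exact: clamp_continuous.
  by apply: cvgMl_tmp; exact: cvg_id.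
by apply: (@continuous_comp _ _ _ (fun t : R => clamp (2 * t - 1)) c2); [exact: lin|exact: h2].
Qed.

Lemma join_fun0 (V : zmodType) (c1 c2 : R -> V) : join_fun c1 c2 0 = c1 0.
Proof. by rewrite /join_fun !clamp_le0 ?addrK//; lra. Qed.

Lemma join_fun1 (V : zmodType) (c1 c2 : R -> V) : c1 1 = c2 0 -> join_fun c1 c2 1 = c2 1.
Proof.
move=> e; rewrite join_fun_cases// ifF ?clamp_ge1//; first by lra.
by apply/negbTE; rewrite -ltNge; lra.
Qed.

Lemma pathlift_join c1 f1 c2 f2 : pathlift c1 f1 -> pathlift c2 f2 ->
  c1 1 = c2 0 -> f1 1 = f2 0 -> pathlift (join_fun c1 c2) (join_fun f1 f2).
Proof.
move=> [a1 b1 d1 e1 g1] [a2 b2 d2 e2 g2] ec ef; split.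
- exact: join_fun_continuous.
- by move=> t; rewrite join_fun_cases//; case: ifP.
- exact: join_fun_continuous.
- by move=> t; rewrite !join_fun_cases//; case: ifP.
- by move=> t; rewrite !join_fun_cases//; case: ifP.
Qed.

Lemma pathlift_rev c f : pathlift c f ->
  pathlift (fun t => c (1 - t)) (fun t => f (1 - t)).
Proof.
have lin : continuous (fun t : R => 1 - t).
  by move=> t; apply: cvgB; [exact: cvg_cst|exact: cvg_id].
move=> [a b d e g]; split=> //.
  by move=> t; apply: (@continuous_comp _ _ _ (fun t : R => 1 - t) c); [exact: lin|exact: a].
by move=> t; apply: (@continuous_comp _ _ _ (fun t : R => 1 - t) f); [exact: lin|exact: d].
Qed.

Lemma pathlift_shift c f (k : int) : pathlift c f ->
  pathlift c (fun t => f t + 2 * k%:~R * pi).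
Proof.
move=> [a b d e g]; split=> //.
- by move=> t; apply: cvgD; [exact: d|exact: cvg_cst].
- by move=> t; rewrite cosD2pi_int.
- by move=> t; rewrite sinD2pi_int.
Qed.

(** Lift the contracting homotopy to the square.  On the three sides where it is
    constant so is its lift, hence the lift takes the same value at both ends of
    the fourth side, which is a lift of the loop. *)
Lemma pathlift_loop c f : loops_contractible R D -> pathlift c f ->
  c 0 = c 1 -> f 0 = f 1.
Proof.
move=> lc [cc cD cf ef ff] c01.
have [||H [cH HD H0 H1 Hs]] := lc c _ _ c01.
- exact: continuous_subspaceT.
- by move=> t _.
pose G (x : R * R) := H (clamp x.1, clamp x.2).
have cl2 : continuous (fun x : R * R => (clamp x.1, clamp x.2)).
  move=> x; apply: (@pair_continuous _ _ _ (fun x : R * R => clamp x.1) (fun x : R * R => clamp x.2)).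
    by apply: (@continuous_comp _ _ _ fst clamp); [exact: cvg_fst|exact: clamp_continuous].
  by apply: (@continuous_comp _ _ _ snd clamp); [exact: cvg_snd|exact: clamp_continuous].
have cG : continuous G.
  by apply: within_comp cH cl2 _ => t; split; exact: clamp_in.
have GD x : D (G x) by apply: HD; exact: clamp_in.
have hC : continuous (C \o G).
  by move=> x; apply: continuous_comp; [exact: cG|apply: cC; exact: GD].
have hS : continuous (S \o G).
  by move=> x; apply: continuous_comp; [exact: cG|apply: cS; exact: GD].
have [F hF] := square_lift hC hS (fun x => CS (GD x)).
have z01 : 0 <= (0 : R) <= 1 by rewrite lexx ler01.
have o01 : 0 <= (1 : R) <= 1 by rewrite lexx ler01.
pose E := [set` `[0 : R, 1]].
have cE : connected E by exact: segment_connected.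
have E0 : E 0 by rewrite /E /= in_itv /= z01.
have E1 : E 1 by rewrite /E /= in_itv /= o01.
have EP t : E t -> 0 <= t <= 1 by rewrite /E /= in_itv.
have edge (p : R -> R * R) (g : R -> R) : continuous p ->
    (forall t, E t -> square (p t)) -> (forall t, E t -> {for t, continuous g}) ->
    (forall t, E t -> cos (g t) = C (G (p t))) ->
    (forall t, E t -> sin (g t) = S (G (p t))) ->
    F (p 0) - g 0 = F (p 1) - g 1.
  move=> cp pK cg cosg sing.
  apply: (lift_unique cE (f := F \o p)) => // t Et; have [h1 h2 h3] := hF _ (pK _ Et).
  - by apply: continuous_comp => //; exact: cp.
  - by rewrite /= h2 cosg.
  - by rewrite /= h3 sing.
have pair_l (a : R) : continuous (fun t : R => (a, t)).
  by move=> t; apply: (@pair_continuous _ _ _ (fun=> a) id); [exact: cvg_cst|exact: cvg_id].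
have pair_r (a : R) : continuous (fun t : R => (t, a)).
  by move=> t; apply: (@pair_continuous _ _ _ id (fun=> a)); [exact: cvg_id|exact: cvg_cst].
have Gl t : E t -> G (0, t) = c t.
  by move=> Et; rewrite /G /= !clamp_id ?EP// H0.
have Gr t : E t -> G (1, t) = c 0.
  by move=> Et; rewrite /G /= !clamp_id ?EP// H1.
have Gd t : E t -> G (t, 0) = c 0.
  by move=> Et; rewrite /G /= !clamp_id ?EP//; have [] := Hs _ Et.
have Gu t : E t -> G (t, 1) = c 0.
  by move=> Et; rewrite /G /= !clamp_id ?EP//; have [] := Hs _ Et.
have e1 : F (0, 0) - f 0 = F (0, 1) - f 1.
  apply: (edge (fun t => (0, t)) f (pair_l 0)) => // t Et.
  - exact: cf.
  - by rewrite Gl.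
  - by rewrite Gl.
have e2 : F (1, 0) - f 0 = F (1, 1) - f 0.
  apply: (edge (fun t => (1, t)) (fun=> f 0) (pair_l 1)) => // t Et.
  - exact: cst_continuous.
  - by rewrite Gr.
  - by rewrite Gr.
have e3 : F (0, 0) - f 0 = F (1, 0) - f 0.
  apply: (edge (fun t => (t, 0)) (fun=> f 0) (pair_r 0)) => // t Et.
  - exact: cst_continuous.
  - by rewrite Gd.
  - by rewrite Gd.
have e4 : F (0, 1) - f 0 = F (1, 1) - f 0.
  apply: (edge (fun t => (t, 1)) (fun=> f 0) (pair_r 1)) => // t Et.
  - exact: cst_continuous.
  - by rewrite Gu.
  - by rewrite Gu.
lra.
Qed.

End angle_lift.

End lifting.

Section global_lift.
Variable R : realType.

Variables (D : set (R * R)) (C S : R * R -> R).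
Hypotheses (cC : forall z, D z -> {for z, continuous C})
  (cS : forall z, D z -> {for z, continuous S})
  (CS : forall z, D z -> C z ^+ 2 + S z ^+ 2 = 1).

Local Notation pathlift := (pathlift D C S).

(** The angle at w is the end of the lift of any path from the base point to w;
    two paths give the same value because one followed by the reverse of the
    other is a loop.  Near w it is continuous since a path to w extended by a
    segment changes the angle by an arcsine. *)
Lemma angle_lift : domain D -> path_connected R D -> loops_contractible R D ->
  exists g : R * R -> R, forall z, D z ->
    [/\ {for z, continuous g}, cos (g z) = C z & sin (g z) = S z].
Proof.
move=> [[z0 Dz0] oD _] pc lc.
have [a0 [ca0 sa0]] := polar_angle (CS Dz0).
pose good (w : R * R) (x : R) := exists c f,
  [/\ pathlift c f, c 0 = z0, f 0 = a0, c 1 = w & f 1 = x].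
have good_ex w : D w -> exists x, good w x.
  move=> Dw; have [c [cc cD c0 c1]] := pc _ _ Dz0 Dw.
  have cc' : continuous (c \o @clamp R).
    by apply: within_comp cc (@clamp_continuous R) _ => t; exact: clamp_in.
  have cD' t : D ((c \o @clamp R) t) by apply: cD; exact: clamp_in.
  have k0 : clamp (0 : R) = 0 by rewrite clamp_le0.
  have k1 : clamp (1 : R) = 1 by rewrite clamp_ge1.
  have [||f [pf f0]] := @pathlift_exists _ _ _ _ cC cS CS _ a0 cc' cD'.
  - by rewrite /= !k0 c0.
  - by rewrite /= !k0 c0.
  exists (f 1), ((c \o @clamp R) \o @clamp R), f; split;
    [exact: pf|by rewrite /= !k0|exact: f0|by rewrite /= !k1|by []].
have good_lift w x : good w x -> [/\ D w, cos x = C w & sin x = S w].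
  by move=> [c [f [[_ cD _ cf sf] _ _ <- <-]]].
have good_uniq w x y : good w x -> good w y -> x = y.
  move=> gx gy.
  have [_ cx sx] := good_lift _ _ gx; have [_ cy sy] := good_lift _ _ gy.
  have [k ky] : exists k : int, x = y + 2 * k%:~R * pi.
    by apply: cos_sin_inj; rewrite ?cx ?cy ?sx ?sy.
  move: gx gy => [c [f [pf c0 f0 c1 f1]]] [c' [f' [pf' c0' f0' c1' f1']]].
  have p2 := pathlift_shift k (pathlift_rev pf').
  have e1 : c 1 = c' (1 - 0) by rewrite subr0 c1 c1'.
  have e2 : f 1 = f' (1 - 0) + 2 * k%:~R * pi by rewrite subr0 f1 f1' ky.
  have p3 := pathlift_join pf p2 e1 e2.
  have := pathlift_loop cC cS CS lc p3.
  rewrite !join_fun0 !join_fun1//= !subrr c0 c0' f0 f0' => /(_ erefl).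
  by rewrite ky; lra.
(* prolonging a path by a short segment *)
have local w : D w -> \forall w' \near w,
    forall x, good w x -> good w' (x + asin (S w' * C w - C w' * S w)).
  move=> Dw.
  have cvC := cC Dw; have cvS := cS Dw.
  have h1 : C w * C w' + S w * S w' @[w' --> w] --> C w * C w + S w * S w.
    by apply: cvgD; apply: cvgMl_tmp.
  have h2 : \forall w' \near w, 0 < C w * C w' + S w * S w'.
    have p : 0 < C w * C w + S w * S w by rewrite -!expr2 CS.
    exact: (cvgr_gt _ h1 _ p).
  have h3 : \forall w' \near w, D w' by apply: open_nbhs_nbhs.
  have [e /= e0 he] := iffLR (nbhs_ballP w _) (filterI h2 h3).
  apply/nbhs_ballP; exists e => //= w' w'e x gx.
  have [_ cx sx] := good_lift _ _ gx.
  pose c (t : R) := w + clamp t *: (w' - w).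
  have cc : continuous c.
    move=> t; apply: cvgD; first exact: cvg_cst.
    by apply: cvgZr_tmp; exact: clamp_continuous.
  have cb t : ball w e (c t).
    rewrite -ball_normE /ball_ /= /c opprD addNKr normrN normrZ.
    have /andP[t0 t1] := clamp_itv t.
    rewrite ger0_norm//; apply: le_lt_trans (ler_piMl _ t1) _ => //.
    by rewrite -ball_normE /ball_ /= distrC in w'e.
  pose f (t : R) := x + asin (S (c t) * C w - C (c t) * S w).
  have c0 : c 0 = w by rewrite /c clamp_le0// scale0r addr0.
  have c1 : c 1 = w' by rewrite /c clamp_ge1// scale1r addrC subrK.
  have cD t : D (c t) by have [] := he _ (cb t).
  have pcf : pathlift c f.
    split=> // t; have [p _] := he _ (cb t).
    - apply: cvgD; first exact: cvg_cst.
      apply: (@continuous_comp _ _ _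
        (fun t : R => S (c t) * C w - C (c t) * S w) (@asin R)).
        apply: cvgB; apply: cvgMr_tmp.
          by apply: (@continuous_comp _ _ _ c S); [exact: cc|exact: cS].
        by apply: (@continuous_comp _ _ _ c C); [exact: cc|exact: cC].
      by apply/continuous_asin/asin_step_lt => //; exact: CS.
    - by have [] := asin_step (CS Dw) (CS (cD t)) p cx sx.
    - by have [] := asin_step (CS Dw) (CS (cD t)) p cx sx.
  move: gx => [d [g [pg d0 g0 d1 g1]]].
  have e1 : d 1 = c 0 by rewrite d1 c0.
  have e2 : g 1 = f 0.
    by rewrite g1 /f c0 mulrC subrr asin0 addr0.
  exists (join_fun d c), (join_fun g f); split.
  - exact: pathlift_join.
  - by rewrite join_fun0.
  - by rewrite join_fun0.
  - by rewrite join_fun1.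
  - by rewrite join_fun1// /f c1.
have /choice[g hg] : forall w, exists x, D w -> good w x.
  move=> w; have [Dw|nDw] := pselect (D w); last by exists 0.
  by have [x gx] := good_ex _ Dw; exists x.
exists g => z Dz; have [_ cz sz] := good_lift _ _ (hg z Dz); split => //.
have near_eq : \forall w' \near z, g z + asin (S w' * C z - C w' * S z) = g w'.
  have h3 : \forall w' \near z, D w' by apply: open_nbhs_nbhs.
  apply: filterS2 (local _ Dz) h3 => w' h Dw'.
  by apply: good_uniq (h _ (hg _ Dz)) (hg _ Dw').
have e : g z + asin (S z * C z - C z * S z) = g z by exact: nbhs_singleton near_eq.
suff : g w' @[w' --> z] --> g z + asin (S z * C z - C z * S z) by rewrite e.
apply: cvg_trans; first by apply: near_eq_cvg; exact: near_eq.
apply: cvgD; first exact: cvg_cst.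
apply: (@continuous_comp _ _ _ (fun w : R * R => S w * C z - C w * S z) (@asin R)).
  by apply: cvgB; apply: cvgMr_tmp; [exact: cS|exact: cC].
apply/continuous_asin/asin_step_lt; [exact: CS|exact: CS|].
by rewrite -!expr2 CS.
Qed.

End global_lift.

(** * Functions with continuous partial derivatives *)

Section calculus.
Variable R : realType.
Implicit Types (D : set (R * R)) (z w : R * R).

Lemma is_derive_linear (V W W' : normedModType R) (L : W -> W') (F : V -> W) (x v : V) d :
  (forall (h : R) a b, L (h *: (a - b)) = h *: (L a - L b)) -> continuous L ->
  is_derive x v F d -> is_derive x v (L \o F) (L d).
Proof.
move=> Llin Lc [Fd Fdv].
have h : (fun h : R => h^-1 *: (((L \o F) \o shift x) (h *: v) - (L \o F) x)) @ 0^' --> L d.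
  under eq_fun do rewrite /= -Llin.
  have h1 : (fun h : R => h^-1 *: ((F \o shift x) (h *: v) - F x)) @ 0^' --> d.
    by rewrite -Fdv.
  exact: (continuous_cvg _ (Lc d) h1).
apply: DeriveDef; first by apply/cvg_ex; exists (L d).
by apply: cvg_lim => //; exact: norm_hausdorff.
Qed.

(** Directional derivatives are derivatives along a line, where the chain rule for
    functions of one variable applies. *)
Lemma is_derive_line (f : R * R -> R) (z w : R * R) (d : R) :
  is_derive z w f d <-> is_derive (0 : R) (1 : R) (fun t => f (t *: w + z)) d.
Proof.
have E : (fun h : R => h^-1 *: (((fun t => f (t *: w + z)) \o shift 0) (h *: (1 : R)) - f (0 *: w + z)))
    = (fun h : R => h^-1 *: ((f \o shift z) (h *: w) - f z)).
  by apply/funext => h /=; rewrite addr0 scale0r add0r [_%:A]mulr1.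
split=> -[fd fE]; (apply: DeriveDef; [move: fd|move: fE]);
  by rewrite /derivable /derive E.
Qed.

Lemma is_derive_line_at (f : R * R -> R) (z w : R * R) (t d : R) :
  is_derive (t *: w + z) w f d -> is_derive t (1 : R) (fun t => f (t *: w + z)) d.
Proof.
have E : (fun h : R => h^-1 *: (((fun t => f (t *: w + z)) \o shift t) (h *: (1 : R)) - f (t *: w + z)))
    = (fun h : R => h^-1 *: ((f \o shift (t *: w + z)) (h *: w) - f (t *: w + z))).
  by apply/funext => h /=; rewrite [_%:A]mulr1 scalerDl addrA.
move=> -[fd fE]; (apply: DeriveDef; [move: fd|move: fE]);
  by rewrite /derivable /derive E.
Qed.

Lemma mean_value_bound (f df : R -> R) (M k : R) :
  (forall t : R, `|t| <= `|k| -> is_derive t (1 : R) f (df t)) ->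
  (forall t : R, `|t| <= `|k| -> `|df t| <= M) -> `|f k - f 0| <= M * `|k|.
Proof.
have pos (g dg : R -> R) (l : R) : 0 <= l ->
    (forall t : R, `|t| <= l -> is_derive t (1 : R) g (dg t)) ->
    (forall t : R, `|t| <= l -> `|dg t| <= M) -> `|g l - g 0| <= M * l.
  move=> l0 gd gM.
  have inl x : 0 <= x <= l -> `|x| <= l by move=> /andP[x0 xl]; rewrite ger0_norm.
  have [||c] := @MVT_segment R g dg 0 l l0.
  - by move=> x; rewrite in_itv /= => /andP[x0 xl]; apply: gd; apply: inl; rewrite !ltW.
  - apply: derivable_within_continuous => x; rewrite in_itv /= => xl.
    by have [] := gd x (inl _ xl).
  rewrite in_itv /= => cl ->; rewrite subr0 normrM (ger0_norm l0).
  by apply: ler_wpM2r => //; apply: gM; exact: inl.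
move=> fd fM; have [k0|k0] := leP 0 k.
  by rewrite (ger0_norm k0) in fd fM *; exact: pos fd fM.
rewrite (ltr0_norm k0) in fd fM *.
have nk : 0 <= - k by rewrite oppr_ge0 ltW.
have := pos (fun t => f (- t)) (fun t => - df (- t)) (- k) nk.
rewrite opprK oppr0; apply.
  move=> t tk; have h := fd (- t); rewrite normrN in h.
  have h1 := h tk; have h2 := is_deriveN (is_derive_id t (1 : R)).
  have h3 := @is_derive1_comp _ f (fun t => - t) t _ _ h1 h2.
  by apply: (is_derive_eq h3); rewrite mulrN1.
by move=> t tk; rewrite normrN; apply: fM; rewrite normrN.
Qed.

Definition rC1_on D (f : R * R -> R) : Prop :=
  forall z, D z ->
    [/\ derivable f z (1, 0), derivable f z (0, 1),
        {for z, continuous ('D_(1, 0) f)} & {for z, continuous ('D_(0, 1) f)}].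

(** Move parallel to one axis and then to the other, applying the mean value
    inequality on each segment. *)
Lemma rC1_continuous D f : open D -> rC1_on D f ->
  forall z, D z -> {for z, continuous f}.
Proof.
move=> oD fC z Dz.
have [_ _ c1 c2] := fC z Dz.
have [M1 [M10 hM1]] : exists M, 0 < M /\ \forall y \near z, `|'D_(1, 0) f y| <= M.
  exists (`|'D_(1, 0) f z| + 1); split; first by rewrite ltr_wpDl.
  have /cvgrPdist_le/(_ 1 ltr01) := c1; apply: filterS => y h.
  by rewrite -[X in `|X|](subKr ('D_(1, 0) f z)); apply: le_trans (ler_normB _ _) _; rewrite lerD2l.
have [M2 [M20 hM2]] : exists M, 0 < M /\ \forall y \near z, `|'D_(0, 1) f y| <= M.
  exists (`|'D_(0, 1) f z| + 1); split; first by rewrite ltr_wpDl.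
  have /cvgrPdist_le/(_ 1 ltr01) := c2; apply: filterS => y h.
  by rewrite -[X in `|X|](subKr ('D_(0, 1) f z)); apply: le_trans (ler_normB _ _) _; rewrite lerD2l.
have nD : \forall y \near z, D y by apply: open_nbhs_nbhs.
have [e /= e0 he] := iffLR (nbhs_ballP z _) (filterI nD (filterI hM1 hM2)).
have inb (a b : R) : `|a| < e -> `|b| < e -> ball z e (z.1 + a, z.2 + b).
  move=> ae be; rewrite -ball_normE /ball_ /= prod_normE /= !opprD !addNKr !normrN.
  by rewrite gt_max ae be.
have n0 : `|0 : R| < e by rewrite normr0.
have bound y : ball z e y -> `|f z - f y| <= (M1 + M2) * `|z - y|.
  move=> zy; set h := y.1 - z.1; set k := y.2 - z.2.
  have nzy : `|z - y| = Num.max `|h| `|k|.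
    by rewrite prod_normE /= /h /k [`|y.1 - _|]distrC [`|y.2 - _|]distrC.
  have hk : `|h| < e /\ `|k| < e.
    move: zy; rewrite -ball_normE /ball_ /= nzy gt_max => /andP[]; by split.
  have [he' ke'] := hk.
  have s1 : `|f (z.1 + h, z.2) - f z| <= M1 * `|h|.
    have pt t : t *: (1, 0) + z = (z.1 + t, z.2 + 0) :> R * R.
      by apply: injective_projections => /=; rewrite /GRing.scale /= ?mulr1 ?mulr0 ?addr0 addrC ?addr0.
    have := @mean_value_bound (fun t => f (t *: (1, 0) + z)) (fun t => 'D_(1, 0) f (t *: (1, 0) + z)) M1 h.
    rewrite scale0r add0r pt addr0; apply.
      move=> t th; apply: is_derive_line_at; apply: derivableP.
      rewrite pt; have [Dt _] := he _ (inb t 0 (le_lt_trans th he') n0).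
      have [fd _ _ _] := fC _ Dt; exact: fd.
    move=> t th; rewrite pt.
    by have [_ []] := he _ (inb t 0 (le_lt_trans th he') n0).
  have s2 : `|f y - f (z.1 + h, z.2)| <= M2 * `|k|.
    have pt t : t *: (0, 1) + (z.1 + h, z.2) = (z.1 + h, z.2 + t) :> R * R.
      by apply: injective_projections => /=; rewrite /GRing.scale /= ?mulr1 ?mulr0 ?add0r // addrC.
    have := @mean_value_bound (fun t => f (t *: (0, 1) + (z.1 + h, z.2)))
      (fun t => 'D_(0, 1) f (t *: (0, 1) + (z.1 + h, z.2))) M2 k.
    have -> : y = (z.1 + h, z.2 + k).
      by apply: injective_projections => /=; rewrite addrC subrK.
    rewrite scale0r add0r pt; apply.
      move=> t tk; apply: is_derive_line_at; apply: derivableP.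
      rewrite pt; have [Dt _] := he _ (inb h t he' (le_lt_trans tk ke')).
      have [_ fd _ _] := fC _ Dt; exact: fd.
    move=> t tk; rewrite pt.
    by have [_ []] := he _ (inb h t he' (le_lt_trans tk ke')).
  rewrite distrC -(subrKA (f (z.1 + h, z.2))); apply: le_trans (ler_normD _ _) _.
  rewrite mulrDl [leRHS]addrC; apply: lerD.
    by apply: le_trans s2 _; rewrite ler_pM2l// nzy le_max lexx orbT.
  by apply: le_trans s1 _; rewrite ler_pM2l// nzy le_max lexx.
have M0 : 0 < M1 + M2 by rewrite addr_gt0.
apply/cvgrPdist_lt => eps eps0.
have d0 : 0 < eps / (M1 + M2) by rewrite divr_gt0.
near=> y.
have zy : ball z e y by near: y; exact: (nbhsx_ballx z e e0).
have zy2 : ball z (eps / (M1 + M2)) y by near: y; exact: (nbhsx_ballx z _ d0).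
apply: le_lt_trans (bound _ zy) _.
by rewrite mulrC -ltr_pdivlMr//; move: zy2; rewrite -ball_normE.
Unshelve. all: by end_near. Qed.

End calculus.

Lemma rC1_of (R : realType) (D : set (R * R)) (oD : open D) (f df1 df2 : R * R -> R) :
  (forall z, D z -> is_derive z (1, 0) f (df1 z) /\ is_derive z (0, 1) f (df2 z)) ->
  (forall z, D z -> {for z, continuous df1} /\ {for z, continuous df2}) ->
  rC1_on D f.
Proof.
move=> fd fc z Dz; have [[d1 e1] [d2 e2]] := fd z Dz; have [c1 c2] := fc z Dz.
have nD : \forall y \near z, D y by apply: open_nbhs_nbhs.
split; [exact: d1|exact: d2| |].
  change ('D_(1, 0) f y @[y --> z] --> 'D_(1, 0) f z); rewrite e1.
  apply: (cvg_trans _ c1); apply: near_eq_cvg; apply: filterS nD => y Dy.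
  by have [[_ ->] _] := fd y Dy.
change ('D_(0, 1) f y @[y --> z] --> 'D_(0, 1) f z); rewrite e2.
apply: (cvg_trans _ c2); apply: near_eq_cvg; apply: filterS nD => y Dy.
by have [_ [_ ->]] := fd y Dy.
Qed.

(** In this section h = u + i v is a nonvanishing C^1 function and g is a
    continuous angle of h, so that g - i (ln |h|) solves exp(i G) = h. *)
Section log.
Variable R : realType.
Variables (D : set (R * R)) (u v g : R * R -> R).
Hypotheses (oD : open D) (uC : rC1_on D u) (vC : rC1_on D v).
Let rho z := u z ^+ 2 + v z ^+ 2.
Hypothesis rho0 : forall z, D z -> rho z != 0.
Hypotheses (gc : forall z, D z -> {for z, continuous g})
  (gcos : forall z, D z -> cos (g z) = u z / Num.sqrt (rho z))
  (gsin : forall z, D z -> sin (g z) = v z / Num.sqrt (rho z)).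

Let rho_gt0 z : D z -> 0 < rho z.
Proof. by move=> Dz; rewrite lt_neqAle eq_sym rho0// addr_ge0// sqr_ge0. Qed.

(** Near z, g is g z plus the arctangent of the ratio of the cross and scalar
    products of h z and h; only the continuity of g is needed to know that no
    multiple of pi intervenes. *)
Lemma arg_derive z w du dv : D z -> is_derive z w u du -> is_derive z w v dv ->
  is_derive z w g ((u z * dv - v z * du) / rho z).
Proof.
move=> Dz /is_derive_line Ud /is_derive_line Vd; apply/is_derive_line.
set U := fun t : R => u (t *: w + z) in Ud.
set V := fun t : R => v (t *: w + z) in Vd.
pose Q t := (V t * u z - U t * v z) * (U t * u z + V t * v z)^-1.
have U0 : U 0 = u z by rewrite /U scale0r add0r.
have V0 : V 0 = v z by rewrite /V scale0r add0r.
have r0 := rho0 Dz.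
have den0 : U 0 * u z + V 0 * v z = rho z by rewrite U0 V0 -!expr2.
have nd : is_derive (0 : R) (1 : R) (fun t => U t * u z + V t * v z) (u z * du + v z * dv).
  have h1 := is_deriveM Ud (is_derive_cst (u z) (0 : R) (1 : R)).
  have h2 := is_deriveM Vd (is_derive_cst (v z) (0 : R) (1 : R)).
  by apply: (is_derive_eq (is_deriveD h1 h2)); rewrite !scaler0 !add0r.
have nn : is_derive (0 : R) (1 : R) (fun t => V t * u z - U t * v z) (u z * dv - v z * du).
  have h1 := is_deriveM Ud (is_derive_cst (v z) (0 : R) (1 : R)).
  have h2 := is_deriveM Vd (is_derive_cst (u z) (0 : R) (1 : R)).
  by apply: (is_derive_eq (is_deriveB h2 h1)); rewrite !scaler0 !add0r.
have den0' : U 0 * u z + V 0 * v z != 0 by rewrite den0.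
have Qd : is_derive (0 : R) (1 : R) Q ((u z * dv - v z * du) / rho z).
  have h := is_deriveM nn (is_deriveV (f := fun t => U t * u z + V t * v z) den0' nd).
  apply: (is_derive_eq h); rewrite den0 U0 V0 [v z * u z]mulrC subrr scale0r add0r.
  by rewrite /GRing.scale /= mulrC.
have Q0 : Q 0 = 0 by rewrite /Q U0 V0 [v z * u z]mulrC subrr mul0r.
have Ad : is_derive (0 : R) (1 : R) (fun t => g z + atan (Q t)) ((u z * dv - v z * du) / rho z).
  have h1 := is_derive1_comp (is_derive1_atan (Q 0)) Qd.
  have h := is_deriveD (is_derive_cst (g z) (0 : R) (1 : R)) h1.
  by apply: (is_derive_eq h); rewrite add0r Q0 expr0n /= addr0 invr1 mul1r.
apply: near_eq_is_derive Ad.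
have ct : (fun t : R => t *: w + z) t @[t --> 0] --> z.
  have : (fun t : R => t *: w + z) t @[t --> 0] --> (0 : R) *: w + z.
    by apply: cvgD; [apply: (@cvgZr_tmp _ _ _ _ _ id 0 w); exact: cvg_id|exact: cvg_cst].
  by rewrite scale0r add0r.
have pi2 : 0 < pi / 2 :> R by rewrite divr_gt0// pi_gt0.
have nD : \forall y \near z, D y by apply: open_nbhs_nbhs.
have ng : \forall y \near z, `|g z - g y| < pi / 2.
  by have /cvgrPdist_lt/(_ _ pi2) := gc Dz.
have H : nbhs (0 : R) (fun t : R => D (t *: w + z) /\ `|g z - g (t *: w + z)| < pi / 2).
  exact: (ct _ (filterI nD ng)).
apply: filterS H => t [Dt gt].
rewrite -[RHS](subrK (g z)) addrC; congr (_ + _).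
have -> : Q t = tan (g (t *: w + z) - g z).
  rewrite /tan sinB cosB !gcos// !gsin// /Q -/(U t) -/(V t).
  have s1 : Num.sqrt (rho z) != 0 by rewrite sqrtr_eq0 -ltNge rho_gt0.
  have s2 : Num.sqrt (rho (t *: w + z)) != 0 by rewrite sqrtr_eq0 -ltNge rho_gt0.
  move: (Num.sqrt (rho z)) (Num.sqrt (rho (t *: w + z))) s1 s2 => a b a0 b0.
  have -> : V t / b * (u z / a) - U t / b * (v z / a) = (V t * u z - U t * v z) / (a * b).
    by field; rewrite a0 b0.
  have -> : U t / b * (u z / a) + V t / b * (v z / a) = (U t * u z + V t * v z) / (a * b).
    by field; rewrite a0 b0.
  by rewrite -mulf_div divff ?mulr1// invr_eq0 mulf_neq0.
rewrite tanK// in_itv /=.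
by move: gt; rewrite distrC ltr_norml.
Qed.

(** Equal to - ln |h|, the imaginary part of the solution of exp(i G) = h. *)
Definition lnmod z := - (ln (rho z) / 2).

Lemma lnmod_derive z w du dv : D z -> is_derive z w u du -> is_derive z w v dv ->
  is_derive z w lnmod (- ((u z * du + v z * dv) / rho z)).
Proof.
move=> Dz /is_derive_line Ud /is_derive_line Vd; apply/is_derive_line.
set U := fun t : R => u (t *: w + z) in Ud.
set V := fun t : R => v (t *: w + z) in Vd.
have r0 := rho_gt0 Dz.
have rd : is_derive (0 : R) (1 : R) (fun t => rho (t *: w + z)) (2 * (u z * du + v z * dv)).
  have h := is_deriveD (is_deriveM Ud Ud) (is_deriveM Vd Vd).
  have U0 : U 0 = u z by rewrite /U scale0r add0r.
  have V0 : V 0 = v z by rewrite /V scale0r add0r.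
  apply: (is_derive_eq h); rewrite U0 V0 /GRing.scale /=; ring.
have r0' : 0 < rho (0 *: w + z) by rewrite scale0r add0r.
have h := @is_derive1_comp _ (@ln R) (fun t => rho (t *: w + z)) 0 _ _ (is_derive1_ln r0') rd.
have h1 := is_deriveN (is_deriveZ (2^-1) h).
rewrite (_ : (fun t => lnmod (t *: w + z)) = (fun t => - (2^-1 *: ln (rho (t *: w + z))))); last first.
  by apply/funext => t; rewrite /lnmod mulrC.
apply: (is_derive_eq h1); rewrite scale0r add0r /GRing.scale /=.
by field; rewrite gt_eqF.
Qed.

Lemma lnmod_arg_rC1 : rC1_on D g /\ rC1_on D lnmod.
Proof.
have uc := rC1_continuous oD uC; have vc := rC1_continuous oD vC.
have rc z : D z -> {for z, continuous (fun z => (rho z)^-1)}.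
  move=> Dz; apply: cvgV; first exact: rho0.
  by apply: cvgD; apply: cvgM; solve [exact: uc|exact: vc].
split.
  apply: (@rC1_of _ _ oD _
    (fun z => (u z * 'D_(1, 0) v z - v z * 'D_(1, 0) u z) / rho z)
    (fun z => (u z * 'D_(0, 1) v z - v z * 'D_(0, 1) u z) / rho z)) => z Dz;
    have [u1 u2 u3 u4] := uC Dz; have [v1 v2 v3 v4] := vC Dz;
    have cu := uc _ Dz; have cv := vc _ Dz; have cr := rc _ Dz.
    by split; apply: arg_derive => //; exact: derivableP.
  split; [exact: (cvgM (cvgB (cvgM cu v3) (cvgM cv u3)) cr)|].
  exact: (cvgM (cvgB (cvgM cu v4) (cvgM cv u4)) cr).
apply: (@rC1_of _ _ oD _
  (fun z => - ((u z * 'D_(1, 0) u z + v z * 'D_(1, 0) v z) / rho z))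
  (fun z => - ((u z * 'D_(0, 1) u z + v z * 'D_(0, 1) v z) / rho z))) => z Dz;
  have [u1 u2 u3 u4] := uC Dz; have [v1 v2 v3 v4] := vC Dz;
  have cu := uc _ Dz; have cv := vc _ Dz; have cr := rc _ Dz.
  by split; apply: lnmod_derive => //; exact: derivableP.
split; [exact: (cvgN (cvgM (cvgD (cvgM cu u3) (cvgM cv v3)) cr))|].
exact: (cvgN (cvgM (cvgD (cvgM cu u4) (cvgM cv v4)) cr)).
Qed.

Lemma lnmod_arg_CR :
  (forall z, D z -> 'D_(1, 0) u z = 'D_(0, 1) v z /\ 'D_(0, 1) u z = - 'D_(1, 0) v z) ->
  forall z, D z -> 'D_(1, 0) g z = 'D_(0, 1) lnmod z /\
    'D_(0, 1) g z = - 'D_(1, 0) lnmod z.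
Proof.
move=> CR z Dz; have [e1 e2] := CR z Dz.
have [u1 u2 _ _] := uC Dz; have [v1 v2 _ _] := vC Dz.
have gd w du dv Du Dv := @derive_val _ _ _ _ _ _ _ (@arg_derive z w du dv Dz Du Dv).
have ld w du dv Du Dv := @derive_val _ _ _ _ _ _ _ (@lnmod_derive z w du dv Dz Du Dv).
rewrite !(gd _ _ _ (derivableP u1) (derivableP v1)) !(gd _ _ _ (derivableP u2) (derivableP v2)).
rewrite !(ld _ _ _ (derivableP u1) (derivableP v1)) !(ld _ _ _ (derivableP u2) (derivableP v2)).
by rewrite e1 e2; split; ring.
Qed.

End log.

Section quat_C1.
Variables (R : realType) (D : set (R * R)).
Hypothesis oD : open D.

Lemma C1_on_real (f : R * R -> R) : rC1_on D f ->
  C1_on D (fun z => (f z)%:A : quat R) /\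
  forall z, D z -> 'D_(1, 0) (fun z => (f z)%:A : quat R) z = ('D_(1, 0) f z)%:A /\
    'D_(0, 1) (fun z => (f z)%:A : quat R) z = ('D_(0, 1) f z)%:A.
Proof.
move=> fC.
have L (z w : R * R) : derivable f z w ->
    is_derive z w (fun z => (f z)%:A : quat R) ('D_w f z)%:A.
  move=> /derivableP fd.
  apply: (@is_derive_linear R _ _ _ (fun a : R => a%:A : quat R) f z w _ _ _ fd).
    by move=> h a b; rewrite -scalerBl scalerA.
  by move=> a; apply: (@cvgZr_tmp _ _ _ _ _ id a (1 : quat R)); exact: cvg_id.
have C (z w : R * R) : D z -> (forall z, D z -> derivable f z w) ->
    {for z, continuous ('D_w f)} ->
    {for z, continuous ('D_w (fun z => (f z)%:A : quat R))}.
  move=> Dz fd fc.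
  have nD : \forall y \near z, D y by apply: open_nbhs_nbhs.
  have E y : D y -> ('D_w f y)%:A = 'D_w (fun z => (f z)%:A : quat R) y.
    by move=> Dy; have [_ <-] := L _ _ (fd _ Dy).
  change ('D_w (fun z => (f z)%:A : quat R) y @[y --> z] -->
    'D_w (fun z => (f z)%:A : quat R) z); rewrite -E//.
  apply: cvg_trans; first by apply: near_eq_cvg; apply: filterS nD; exact: E.
  by apply: cvgZr_tmp.
split=> z Dz; have [f1 f2 f3 f4] := fC z Dz.
  split; [by have [] := L _ _ f1|by have [] := L _ _ f2| |].
    have fd1 y : D y -> derivable f y (1, 0) by case/fC.
    have H := C z (1, 0) Dz fd1 f3.
    exact: H.
  have fd2 y : D y -> derivable f y (0, 1) by case/fC.
  exact: (C z (0, 1) Dz fd2 f4).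
by split; [have [_ ->] := L _ _ f1|have [_ ->] := L _ _ f2].
Qed.

Lemma coord_C1_on (L : quat R -> R) (F : R * R -> quat R) :
  (forall (h : R) a b, L (h *: (a - b)) = h *: (L a - L b)) -> continuous L ->
  C1_on D F -> rC1_on D (L \o F) /\
  forall z, D z -> 'D_(1, 0) (L \o F) z = L ('D_(1, 0) F z) /\
    'D_(0, 1) (L \o F) z = L ('D_(0, 1) F z).
Proof.
move=> Ll Lc FC.
have H (z w : R * R) : derivable F z w -> is_derive z w (L \o F) (L ('D_w F z)).
  by move=> /derivableP; exact: is_derive_linear.
split=> [|z Dz]; last first.
  by have [f1 f2 _ _] := FC z Dz; split; [have [_ ->] := H _ _ f1|have [_ ->] := H _ _ f2].
apply: (@rC1_of _ _ oD _ (L \o 'D_(1, 0) F) (L \o 'D_(0, 1) F)) => z Dz;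
    have [f1 f2 f3 f4] := FC z Dz.
  by split; exact: H.
split.
  exact: (continuous_comp f3 (Lc _)).
exact: (continuous_comp f4 (Lc _)).
Qed.

End quat_C1.

(** * The complex exponential, cosine and sine *)

Import complex.
Local Open Scope complex_scope.

(** One step of the estimate of a Taylor remainder: a bound on the derivative
    integrates to a bound on the function. *)
Lemma taylor_step_bound (R : realType) (f df : R -> R) (C : R) (n : nat) :
  (forall t : R, is_derive t (1 : R) f (df t)) -> f 0 = 0 ->
  (forall t : R, 0 <= t -> t <= 1 -> `|df t| <= C * t ^+ n) ->
  forall t : R, 0 <= t -> t <= 1 -> `|f t| <= C * (t ^+ n.+1 / n.+1%:R).
Proof.
move=> dfE f0 dfC t t0 t1.
have key (s : R) : s ^+ 2 = 1 -> s * f t <= C * (t ^+ n.+1 / n.+1%:R).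
  move=> s2.
  pose g := fun t : R => C * (n.+1%:R^-1 * t ^+ n.+1) - s * f t.
  have dg (u : R) : is_derive u (1 : R) g (C * u ^+ n - s * df u).
    have h1 := dfE u.
    have h2 : is_derive u (1 : R) (fun u : R => u ^+ n.+1) (n.+1%:R * u ^+ n).
      by apply: DeriveDef; [exact: exprn_derivable|
        rewrite exp_derive /GRing.scale /= mulr1].
    have h3 := is_deriveZ (n.+1%:R^-1) h2.
    have h4 := is_deriveZ C h3.
    have h5 := is_deriveZ s h1.
    have h6 := is_deriveB h4 h5.
    apply: (is_derive_eq h6).
    by rewrite /GRing.scale /= mulKf ?pnatr_eq0.
  have [//|c] := @MVT_segment R g (fun u => C * u ^+ n - s * df u) 0 t t0 (fun x _ => dg x).
    apply: derivable_within_continuous => x _.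
    by have := dg x; case.
  rewrite in_itv /= => /andP[c0 ct].
  have -> : g 0 = 0 by rewrite /g f0 expr0n /= !mulr0 subr0.
  rewrite !subr0 => gt.
  have : 0 <= g t.
    rewrite gt mulr_ge0// subr_ge0.
    apply: le_trans (dfC _ c0 (le_trans ct t1)).
    apply: le_trans (ler_norm _) _.
    rewrite normrM.
    have -> : `|s| = 1.
      by apply/eqP; rewrite -sqrp_eq1// -normrX s2 normr1.
    by rewrite mul1r.
  by rewrite /g subr_ge0 [_^-1 * _]mulrC.
rewrite ler_norml lerNl -mulN1r key ?sqrrN ?expr1n//=.
by rewrite -[f t]mul1r key ?expr1n.
Qed.

Section complex_exponential.
Variable R : realType.
Implicit Types z w : R[i].

Definition cexp z : R[i] :=
  (expR (Re z) * cos (Im z)) +i* (expR (Re z) * sin (Im z)).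

(** By components, because the components are the real coefficients of the
    quaternionic series to be summed (stem_series). *)
Definition ccvg (u : nat -> R[i]) (l : R[i]) : Prop :=
  (fun n => Re (u n)) @ \oo --> Re l /\ (fun n => Im (u n)) @ \oo --> Im l.

Lemma ReM z w : Re (z * w) = Re z * Re w - Im z * Im w.
Proof. by case: z; case: w. Qed.
Lemma ImM z w : Im (z * w) = Re z * Im w + Im z * Re w.
Proof. by case: z; case: w. Qed.
Lemma ReD z w : Re (z + w) = Re z + Re w.
Proof. by case: z; case: w. Qed.
Lemma ImD z w : Im (z + w) = Im z + Im w.
Proof. by case: z; case: w. Qed.
Lemma ReN z : Re (- z) = - Re z.
Proof. by case: z. Qed.
Lemma ImN z : Im (- z) = - Im z.
Proof. by case: z. Qed.
Lemma Re_rC (x : R) : Re x%:C = x. Proof. by []. Qed.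
Lemma Im_rC (x : R) : Im x%:C = 0. Proof. by []. Qed.

Lemma Re_C (x y : R) : Re (x +i* y) = x. Proof. by []. Qed.
Lemma Im_C (x y : R) : Im (x +i* y) = y. Proof. by []. Qed.

Definition ReImE := (Re_C, Im_C, ReM, ImM, ReD, ImD, ReN, ImN, Re_rC, Im_rC).

Lemma complex_eqP z w : Re z = Re w -> Im z = Im w -> z = w.
Proof. by case: z; case: w => /= ? ? ? ? -> ->. Qed.

Lemma Re_sum n (u : nat -> R[i]) :
  Re (\sum_(0 <= k < n) u k) = \sum_(0 <= k < n) Re (u k).
Proof. by elim/big_rec2: _ => [//|k x y _ <-]; rewrite ReD. Qed.
Lemma Im_sum n (u : nat -> R[i]) :
  Im (\sum_(0 <= k < n) u k) = \sum_(0 <= k < n) Im (u k).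
Proof. by elim/big_rec2: _ => [//|k x y _ <-]; rewrite ImD. Qed.

Lemma Re_cexp z : Re (cexp z) = expR (Re z) * cos (Im z). Proof. by []. Qed.
Lemma Im_cexp z : Im (cexp z) = expR (Re z) * sin (Im z). Proof. by []. Qed.

Lemma cexp_mulN z : cexp z * cexp (- z) = 1.
Proof.
have e0 : expR (Re z) != 0 by rewrite gt_eqF// expR_gt0.
have cs := cos2Dsin2 (Im z).
apply: complex_eqP; 
  rewrite !(Re_cexp, Im_cexp, ReImE) expRN cosN sinN; last first.
  by change (Im (1 : R[i])) with (0 : R); ring.
change (Re (1 : R[i])) with (1 : R).
transitivity (cos (Im z) ^+ 2 + sin (Im z) ^+ 2); last by rewrite cs.
by field.
Qed.

Local Notation rem f p := (fun t => f t - horner p t).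

(** Along t |-> exp (t z), the derivative of each Taylor remainder is z times the
    previous one, so by induction the n-th remainder is at most
    exp K * K ^ n / n!, where K = |Re z| + |Im z|. *)
Lemma cexp_series z :
  ccvg (fun n => \sum_(0 <= k < n) (k`!%:R^-1)%:C * z ^+ k) (cexp z).
Proof.
set x := Re z; set y := Im z.
pose p n := \poly_(k < n) (k`!%:R^-1 * Re (z ^+ k)).
pose q n := \poly_(k < n) (k`!%:R^-1 * Im (z ^+ k)).
have dcoef n (c : nat -> R) :
    (\poly_(k < n.+1) (k`!%:R^-1 * c k))^`() = \poly_(k < n) (k`!%:R^-1 * c k.+1).
  apply/polyP => k; rewrite coef_deriv !coef_poly ltnS.
  case: ifP => _; last by rewrite mul0rn.
  rewrite factS natrM -mulr_natr.
  have h1 : k.+1%:R != 0 :> R by rewrite pnatr_eq0.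
  have h2 : k`!%:R != 0 :> R by rewrite pnatr_eq0 -lt0n fact_gt0.
  by field; rewrite h2 nat1r h1.
have dp n : (p n.+1)^`() = x *: p n - y *: q n.
  rewrite dcoef; apply/polyP => k; rewrite coefB !coefZ !coef_poly.
  case: ifP => _; last by rewrite !mulr0 subr0.
  by rewrite exprS ReM -/x -/y; ring.
have dq n : (q n.+1)^`() = x *: q n + y *: p n.
  rewrite dcoef; apply/polyP => k; rewrite coefD !coefZ !coef_poly.
  case: ifP => _; last by rewrite !mulr0 addr0.
  by rewrite exprS ImM -/x -/y; ring.
pose e t := expR (x * t) * cos (y * t).
pose f t := expR (x * t) * sin (y * t).
have dlin (a t : R) : is_derive t (1 : R) (fun t : R => a * t) a.
  have h := is_deriveZ a (is_derive_id t (1 : R)).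
  by apply: (is_derive_eq h); rewrite /GRing.scale /= mulr1.
have dE t : is_derive t (1 : R) (fun t => expR (x * t)) (x * expR (x * t)).
  have h := is_derive1_comp (is_derive_expR (x * t)) (dlin x t).
  by apply: (is_derive_eq h); rewrite mulrC.
have dC t : is_derive t (1 : R) (fun t => cos (y * t)) (- y * sin (y * t)).
  have h := is_derive1_comp (is_derive_cos (y * t)) (dlin y t).
  by apply: (is_derive_eq h); rewrite mulrC mulrN mulNr.
have dS t : is_derive t (1 : R) (fun t => sin (y * t)) (y * cos (y * t)).
  have h := is_derive1_comp (is_derive_sin (y * t)) (dlin y t).
  by apply: (is_derive_eq h); rewrite mulrC.
have de t : is_derive t (1 : R) e (x * e t - y * f t).
  have h := is_deriveM (dE t) (dC t).
  by apply: (is_derive_eq h); rewrite /GRing.scale /= /e /f; ring.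
have df t : is_derive t (1 : R) f (x * f t + y * e t).
  have h := is_deriveM (dE t) (dS t).
  by apply: (is_derive_eq h); rewrite /GRing.scale /= /e /f; ring.
have dr n t : is_derive t (1 : R) (rem e (p n.+1))
    (x * rem e (p n) t - y * rem f (q n) t).
  have h := is_deriveB (de t) (is_derive_poly (p n.+1) t).
  apply: (is_derive_eq h); rewrite dp hornerD hornerN !hornerZ; ring.
have ds n t : is_derive t (1 : R) (rem f (q n.+1))
    (x * rem f (q n) t + y * rem e (p n) t).
  have h := is_deriveB (df t) (is_derive_poly (q n.+1) t).
  apply: (is_derive_eq h); rewrite dq hornerD !hornerZ; ring.
(* K bounds the effect of a multiplication by z on the maximum of the
   absolute values of the two components. *)
pose K := `|x| + `|y|.
pose M := expR K.
have K0 : 0 <= K by rewrite /K addr_ge0.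
have bnd n t : 0 <= t -> t <= 1 ->
    `|rem e (p n) t| <= M * (K ^+ n * t ^+ n / n`!%:R) /\
    `|rem f (q n) t| <= M * (K ^+ n * t ^+ n / n`!%:R).
  elim: n t => [|n IH] t t0 t1.
    rewrite /p /q !poly_def !big_ord0 !horner0 !subr0 !expr0 !mulr1 fact0 divr1 mulr1.
    have : expR (x * t) <= M.
      rewrite ler_expR /K.
      apply: le_trans (ler_norm _) _; rewrite normrM (ger0_norm t0).
      by apply: le_trans (ler_piMr _ t1) _ => //; rewrite lerDl.
    move=> eM; rewrite !normrM !(ger0_norm (expR_ge0 _)).
    split; apply: le_trans eM; apply: ler_piMr; rewrite ?expR_ge0 ?cos_max ?sin_max//.
  have bound (a b u : R) : `|a| <= M * (K ^+ n * u ^+ n / n`!%:R) ->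
      `|b| <= M * (K ^+ n * u ^+ n / n`!%:R) ->
      `|x * a + y * b| <= (M * K ^+ n.+1 / n`!%:R) * u ^+ n.
    move=> ha hb.
    have -> : (M * K ^+ n.+1 / n`!%:R) * u ^+ n =
        `|x| * (M * (K ^+ n * u ^+ n / n`!%:R)) +
        `|y| * (M * (K ^+ n * u ^+ n / n`!%:R)).
      by rewrite exprS {1}/K; ring.
    apply: le_trans (ler_normD _ _) _; rewrite !normrM.
    by apply: lerD; apply: ler_wpM2l.
  have fin : (M * K ^+ n.+1 / n`!%:R) * (t ^+ n.+1 / n.+1%:R) =
      M * (K ^+ n.+1 * t ^+ n.+1 / n.+1`!%:R).
    by rewrite factS natrM invfM; ring.
  rewrite -fin; split.
    apply: (taylor_step_bound (dr n)) => //.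
      rewrite /e /p horner_poly big_ord_recl big1 => [|i _].
        have -> : nat_of_ord (ord0 : 'I_n.+1) = 0%N by [].
        by rewrite !expr0 !mulr0 expR0 cos0 fact0 invr1 addr0 !mulr1 /= subrr.
      by rewrite /bump /= expr0n mulr0.
    move=> u u0 u1; have [h1 h2] := IH u u0 u1.
    by rewrite -mulrN; apply: bound => //; rewrite normrN.
  apply: (taylor_step_bound (ds n)) => //.
    rewrite /f /q horner_poly big_ord_recl big1 => [|i _].
        have -> : nat_of_ord (ord0 : 'I_n.+1) = 0%N by [].
        by rewrite !expr0 !mulr0 expR0 sin0 mulr0 mul0r addr0 subr0.
    by rewrite /bump /= expr0n mulr0.
  move=> u u0 u1; have [h1 h2] := IH u u0 u1; exact: bound.
have lim0 : (fun n => M * (K ^+ n / n`!%:R)) @ \oo --> (0 : R).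
  rewrite -(mulr0 M); apply: cvgMl_tmp.
  exact: (cvg_exp_coeff K).
have squeeze (u : nat -> R) (l : R) :
    (forall n, `|l - u n| <= M * (K ^+ n / n`!%:R)) -> u @ \oo --> l.
  move=> ul; apply/cvgrPdist_le => eps eps0.
  move/cvgrPdist_le : lim0 => /(_ _ eps0); apply: filterS => n /=.
  rewrite sub0r normrN => h; apply: le_trans (ul n) _.
  exact: le_trans (ler_norm _) h.
split; apply: squeeze => n /=.
- have [+ _] := bnd n 1 ler01 (lexx _).
  rewrite expr1n mulr1 /e !mulr1 /p horner_poly Re_sum big_mkord.
  congr (`|_ - _| <= _); apply: eq_bigr => k _.
  by rewrite expr1n mulr1 ReM /= mul0r subr0.
- have [_ +] := bnd n 1 ler01 (lexx _).
  rewrite expr1n mulr1 /f !mulr1 /q horner_poly Im_sum big_mkord.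
  congr (`|_ - _| <= _); apply: eq_bigr => k _.
  by rewrite expr1n mulr1 ImM /= mul0r addr0.
Qed.

End complex_exponential.

Section complex_trigonometry.
Variable R : realType.
Implicit Types z w : R[i].

Lemma cexp_inj z w : cexp z = cexp w ->
  Re z = Re w /\ exists k : int, Im z = Im w + 2 * k%:~R * pi.
Proof.
move=> e; have := congr1 (@Re R) e; have := congr1 (@Im R) e.
rewrite !Re_cexp !Im_cexp => e1 e2.
have E : expR (Re z) ^+ 2 = expR (Re w) ^+ 2.
  rewrite -[LHS]mulr1 -(cos2Dsin2 (Im z)) mulrDr -!exprMn e1 e2.
  by rewrite !exprMn -mulrDr cos2Dsin2 mulr1.
have E' : expR (Re z) = expR (Re w).
  by apply/eqP; move/eqP: E; rewrite eqrXn2// expR_ge0.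
rewrite E' in e1 e2.
have nz : expR (Re w) != 0 by rewrite gt_eqF// expR_gt0.
split; first exact: expR_inj.
by apply: cos_sin_inj; [exact: (mulfI nz) e2|exact: (mulfI nz) e1].
Qed.

Definition ci : R[i] := 0 +i* 1.
Lemma ci2 : ci * ci = -1.
Proof. by apply: complex_eqP; rewrite ?ReM ?ImM ?ReN ?ImN /=; ring. Qed.

Definition ccos z : R[i] := 2^-1 * (cexp (ci * z) + cexp (- (ci * z))).
Definition csin z : R[i] := - ci / 2 * (cexp (ci * z) - cexp (- (ci * z))).

Lemma ccos_csin z : ccos z + ci * csin z = cexp (ci * z).
Proof.
rewrite /ccos /csin mulrA mulrA mulrN ci2; move: (cexp _) (cexp _) => a b.
by field; rewrite ?pnatr_eq0.
Qed.

Lemma ccos2Dcsin2 z : ccos z ^+ 2 + csin z ^+ 2 = 1.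
Proof.
rewrite /ccos /csin !exprMn sqrrN (expr2 ci) ci2.
transitivity (cexp (ci * z) * cexp (- (ci * z))); last exact: cexp_mulN.
by field.
Qed.

Lemma ccvgD u v l m : @ccvg R u l -> ccvg v m -> ccvg (fun n => u n + v n) (l + m).
Proof.
move=> [u1 u2] [v1 v2]; split.
  by under eq_fun do rewrite ReD; rewrite ReD; exact: cvgD.
by under eq_fun do rewrite ImD; rewrite ImD; exact: cvgD.
Qed.

Lemma ccvgMr u l c : @ccvg R u l -> ccvg (fun n => c * u n) (c * l).
Proof.
move=> [u1 u2]; split.
  under eq_fun do rewrite ReM; rewrite ReM.
  by apply: cvgB; apply: cvgMl_tmp.
under eq_fun do rewrite ImM; rewrite ImM.
by apply: cvgD; apply: cvgMl_tmp.
Qed.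

Lemma ccvg_double u l : @ccvg R u l -> ccvg (fun n => u (2 * n)%N) l.
Proof.
have h := @cvg_mulnl 2 isT.
move=> [u1 u2]; split.
  exact: (cvg_comp _ _ h u1).
exact: (cvg_comp _ _ h u2).
Qed.

Let S (w : R[i]) n := \sum_(0 <= k < n) (k`!%:R^-1)%:C * w ^+ k.

Lemma rCM (x y : R) : (x * y)%:C = x%:C * y%:C :> R[i].
Proof. by apply: complex_eqP; rewrite ?ReM ?ImM /=; ring. Qed.

Lemma ci_exp2 z n : (ci * z) ^+ (2 * n) = ((-1) ^+ n)%:C * z ^+ (2 * n).
Proof.
rewrite !exprM [(ci * z) ^+ 2]exprMn (expr2 ci) ci2 exprMn; congr (_ * _).
by rewrite (rmorphXn (real_complex R)) rmorphN1.
Qed.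

(** The even part of the exponential series of i z, from partial sums of twice
    the length. *)
Lemma ccos_series z :
  ccvg (fun n => \sum_(0 <= k < n)
    ((-1) ^+ k / (2 * k)`!%:R)%:C * z ^+ (2 * k)) (ccos z).
Proof.
have -> : (fun n => \sum_(0 <= k < n)
    ((-1) ^+ k / (2 * k)`!%:R)%:C * z ^+ (2 * k)) =
  (fun n => 2^-1 * (S (ci * z) (2 * n)%N + S (- (ci * z)) (2 * n)%N)).
  apply/funext; elim=> [|n IH].
    by rewrite /S !muln0 !big_geq// addr0 mulr0.
  rewrite big_nat_recr//= IH /S mulnS !addSn add0n !big_nat_recr//=.
  rewrite !exprS -/(S _ _) -/(S _ _) !(exprNn (ci * z)) (exprM (-1 : R[i])).
  rewrite sqrrN !expr1n !mul1r ci_exp2 rCM.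
  by move: (S _ _) (S _ _) (_%:C) (_%:C) (_%:C) => a b c d e; field.
apply: ccvgMr; apply: ccvgD; apply: ccvg_double; exact: cexp_series.
Qed.

Lemma csin_series z :
  ccvg (fun n => \sum_(0 <= k < n)
    ((-1) ^+ k / (2 * k).+1`!%:R)%:C * z ^+ (2 * k).+1) (csin z).
Proof.
have -> : (fun n => \sum_(0 <= k < n)
    ((-1) ^+ k / (2 * k).+1`!%:R)%:C * z ^+ (2 * k).+1) =
  (fun n => - ci / 2 * (S (ci * z) (2 * n)%N + -1 * S (- (ci * z)) (2 * n)%N)).
  apply/funext; elim=> [|n IH].
    by rewrite /S !muln0 !big_geq// mulr0 addr0 mulr0.
  rewrite big_nat_recr//= IH /S mulnS !addSn add0n !big_nat_recr//=.
  rewrite !exprS -/(S _ _) -/(S _ _) !(exprNn (ci * z)) (exprM (-1 : R[i])).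
  rewrite sqrrN !expr1n !mul1r ci_exp2 rCM.
  move: (S _ _) (S _ _) (_%:C) (_%:C) (_%:C) (z ^+ _) => a b c d e f.
  transitivity (- ci / 2 * (b - a) - (ci * ci) * e * d * z * f); last by field.
  by rewrite ci2; field.
apply: ccvgMr; rewrite -[- cexp _]mulN1r; apply: ccvgD; last apply: ccvgMr.
  by apply: ccvg_double; exact: cexp_series.
by apply: ccvg_double; exact: cexp_series.
Qed.

End complex_trigonometry.

(** * Quaternions and values of stem functions *)

Section quat_alg.
Variable R : realType.
Implicit Types p q r I J : quat R.

Lemma qcoordN p :
  ((qre (- p) = - qre p)%R * (qi (- p) = - qi p)%R *
   (qj (- p) = - qj p)%R * (qk (- p) = - qk p)%R)%type.
Proof. by rewrite /qre /qi /qj /qk !mxE. Qed.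

Lemma qcoord1 :
  ((qre (1 : quat R) = 1)%R * (qi (1 : quat R) = 0)%R *
   (qj (1 : quat R) = 0)%R * (qk (1 : quat R) = 0)%R)%type.
Proof. by rewrite qoneE /qone !qcoordE. Qed.

Lemma qcoordM p q :
  ((qre (p * q) = qre p * qre q - qi p * qi q - qj p * qj q - qk p * qk q)%R *
   (qi (p * q) = qre p * qi q + qi p * qre q + qj p * qk q - qk p * qj q)%R *
   (qj (p * q) = qre p * qj q - qi p * qk q + qj p * qre q + qk p * qi q)%R *
   (qk (p * q) = qre p * qk q + qi p * qj q - qj p * qi q + qk p * qre q)%R)%type.
Proof. by rewrite qmulE /qmul !qcoordE. Qed.

Definition qcoords := (qcoordD, qcoordN, qcoordZ, qcoordM, qcoord1, qcoord0, qcoordE).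

(** A quaternion with nonzero real part whose square is real is itself real, so
    its square cannot be -1. *)
Lemma imag_sphereP I : imag_sphere I <->
  qre I = 0 /\ qi I ^+ 2 + qj I ^+ 2 + qk I ^+ 2 = 1.
Proof.
rewrite /imag_sphere /= expr2; split=> [e|[e0 e1]].
  have := congr1 (@qre R) e; have := congr1 (@qi R) e.
  have := congr1 (@qj R) e; have := congr1 (@qk R) e.
  rewrite !qcoords; move: (qre I) (qi I) (qj I) (qk I) => a b c d h1 h2 h3 h4.
  have [a0|a0] := eqVneq a 0.
    by split=> //; rewrite a0 in h4; lra.
  have z x : 2 * a * x = 0 -> x = 0.
    by move=> /eqP; rewrite !mulf_eq0 (negbTE a0) pnatr_eq0 /= => /eqP.
  have d0 : d = 0 by apply: z; lra.
  have c0 : c = 0 by apply: z; lra.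
  have b0 : b = 0 by apply: z; lra.
  by have := sqr_ge0 a; rewrite b0 c0 d0 in h4; lra.
by apply: quat_eqP; rewrite !qcoords e0; [lra|ring|ring|ring].
Qed.

Lemma imag_sphereN I : imag_sphere I -> imag_sphere (- I).
Proof. by rewrite /imag_sphere /= sqrrN. Qed.

Lemma qunitE p : (p \is a GRing.unit) = (p != 0).
Proof. by []. Qed.

Lemma imag_sphereJ I p : imag_sphere I -> p != 0 -> imag_sphere (p^-1 * I * p).
Proof.
rewrite /imag_sphere /= !expr2 => I2 p0.
rewrite (_ : p^-1 * I * p * _ = p^-1 * I * (p * p^-1) * I * p); last by rewrite !mulrA.
rewrite divrr; last by rewrite qunitE.
by rewrite mulr1 -(mulrA p^-1) I2 mulrN1 mulNr mulVr// qunitE.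
Qed.

Lemma slice_ptE I z : slice_pt I z = z.1%:A + z.2 *: I.
Proof. by []. Qed.

Lemma qvecE p :
  ((qre (qvec p) = 0)%R * (qi (qvec p) = qi p)%R *
   (qj (qvec p) = qj p)%R * (qk (qvec p) = qk p)%R)%type.
Proof. by rewrite /qvec !qcoords !mulr0 !oppr0 !addr0 mulr1 subrr. Qed.

Lemma slice_pt_proj I z : imag_sphere I ->
  qre (slice_pt I z) = z.1 /\ qnorm (qvec (slice_pt I z)) = `|z.2| /\
  qvec (slice_pt I z) = z.2 *: I.
Proof.
move=> /imag_sphereP[I0 I1].
have re : qre (slice_pt I z) = z.1 by rewrite slice_ptE !qcoords I0; ring.
have ve : qvec (slice_pt I z) = z.2 *: I by rewrite /qvec re slice_ptE addrC addKr.
split=> //; split=> //.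
rewrite /qnorm -sqrtr_sqr ve; congr Num.sqrt.
by rewrite /qnorm2 !qcoords I0 -[RHS]mulr1 -I1; ring.
Qed.

Lemma slice_pt_sphere I J z : imag_sphere I -> imag_sphere J ->
  qsphere (slice_pt I z) (slice_pt J z).
Proof.
move=> Is Js; have [re [nm _]] := slice_pt_proj z Is.
have [z0|z0] := leP 0 z.2.
  by exists J => //; rewrite re nm ger0_norm.
exists (- J); first exact: imag_sphereN.
by rewrite re nm ltr0_norm// scalerN scaleNr opprK.
Qed.

(** The value at z of the stem function of f is p + i r, where i is the imaginary
    unit of the complexified quaternions. *)
Definition stem_on (f : quat R -> quat R) (z : R * R) (p r : quat R) :=
  forall I, imag_sphere I -> f (slice_pt I z) = p + I * r.

(** The star product conjugates the argument by f q = p + I r, which turns I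
    into J with (p + I r) J = I (p + I r); hence the product of the values is the
    value of the product in the complexified quaternions. *)
Lemma star_stem f g z p r p' r' :
  stem_on f z p r -> stem_on g z p' r' ->
  stem_on (star f g) z (p * p' - r * r') (p * r' + r * p').
Proof.
move=> fE gE I Is; rewrite /star fE//.
have -> : p * p' - r * r' + I * (p * r' + r * p') =
    (p + I * r) * p' + I * ((p + I * r) * r').
  rewrite !mulrDl !mulrDr !mulrA.
  have -> : I * I = -1 by rewrite -expr2.
  by rewrite mulN1r mulNr [I * p * r' + _]addrC addrACA [- _ + _]addrC.
have [->|a0] := eqVneq (p + I * r) 0; first by rewrite !mul0r mulr0 addr0.
move: (p + I * r) a0 => a a0.
have -> : a^-1 * slice_pt I z * a = slice_pt (a^-1 * I * a) z.
  rewrite !slice_ptE mulrDr mulrDl -(scalerAr z.1) -(scalerAr z.2) -(scalerAl z.1) -(scalerAl z.2) mulr1 mulVr ?qunitE//.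
rewrite gE; last exact: imag_sphereJ.
by rewrite mulrDr -(mulrA a^-1) !mulrA divrr ?qunitE// mul1r.
Qed.

(** For imaginary p and r, stem0 and stem1 are the two components of A + B f_v in
    the complexified quaternions, where A and B are complex and f_v = p + i r. *)
Definition stem0 p r (A B : R[i]) : quat R :=
  (Re A)%:A + Re B *: p - Im B *: r.
Definition stem1 p r (A B : R[i]) : quat R :=
  (Im A)%:A + Im B *: p + Re B *: r.

(** The complex number N with (f_v)^2 = - N, where f_v is the vector part of
    p + i r. *)
Definition qdisc p r : R[i] :=
  (qi p ^+ 2 + qj p ^+ 2 + qk p ^+ 2 - (qi r ^+ 2 + qj r ^+ 2 + qk r ^+ 2)) +i*
  (2 * (qi p * qi r + qj p * qj r + qk p * qk r)).

(** Powers of f_0 + f_v stay in the span of 1 and f_v over the complex numbers. *)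
Lemma star_pow_stem f z F0 F1 (a b : nat -> R[i]) :
  stem_on f z F0 F1 -> a 0%N = 1 -> b 0%N = 0 ->
  (forall n, a n.+1 = (qre F0 +i* qre F1) * a n - qdisc F0 F1 * b n) ->
  (forall n, b n.+1 = a n + (qre F0 +i* qre F1) * b n) ->
  forall n, stem_on (star_pow f n) z
    (stem0 (qvec F0) (qvec F1) (a n) (b n)) (stem1 (qvec F0) (qvec F1) (a n) (b n)).
Proof.
move=> fE a0 b0 aS bS; elim=> [|n IH].
  move=> I Is; rewrite /star_pow /stem0 /stem1 a0 b0 /= !scale0r.
  by rewrite subr0 !addr0 scale1r mulr0 addr0.
have := star_stem fE IH; rewrite -/(star_pow f n.+1).
set P := (X in stem_on _ _ X _); set Q := (X in stem_on _ _ _ X).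
have -> : P = stem0 (qvec F0) (qvec F1) (a n.+1) (b n.+1).
  rewrite /P /stem0 /stem1 aS bS /qdisc !ReImE.
  move: (Re (a n)) (Im (a n)) (Re (b n)) (Im (b n)) => a1 a2 b1 b2.
  by apply: quat_eqP; rewrite !(qcoords, qvecE); ring.
have -> // : Q = stem1 (qvec F0) (qvec F1) (a n.+1) (b n.+1).
rewrite /Q /stem0 /stem1 aS bS /qdisc !ReImE.
move: (Re (a n)) (Im (a n)) (Re (b n)) (Im (b n)) => a1 a2 b1 b2.
by apply: quat_eqP; rewrite !(qcoords, qvecE); ring.
Qed.

Lemma stem_series p r I (c : nat -> R) (a b : nat -> R[i]) (A B : R[i]) :
  ccvg (fun n => \sum_(0 <= k < n) (c k)%:C * a k) A ->
  ccvg (fun n => \sum_(0 <= k < n) (c k)%:C * b k) B ->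
  limn (series (fun k => c k *: (stem0 p r (a k) (b k) + I * stem1 p r (a k) (b k)))) =
  stem0 p r A B + I * stem1 p r A B.
Proof.
move=> [A1 A2] [B1 B2].
have E (X Y : R[i]) : stem0 p r X Y + I * stem1 p r X Y =
    Re X *: 1 + Im X *: I + Re Y *: (p + I * r) + Im Y *: (I * p - r).
  by rewrite /stem0 /stem1; apply: quat_eqP; rewrite !qcoords; ring.
rewrite E; apply: cvg_lim; first exact: norm_hausdorff.
have -> : series (fun k => c k *: (stem0 p r (a k) (b k) + I * stem1 p r (a k) (b k))) =
  (fun n => Re (\sum_(0 <= k < n) (c k)%:C * a k) *: 1 +
    Im (\sum_(0 <= k < n) (c k)%:C * a k) *: I +
    Re (\sum_(0 <= k < n) (c k)%:C * b k) *: (p + I * r) +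
    Im (\sum_(0 <= k < n) (c k)%:C * b k) *: (I * p - r)).
  apply/funext => n; rewrite /series /=; elim: n => [|n IH].
    by rewrite !big_geq//= !scale0r !addr0.
  rewrite big_nat_recr//= IH !(big_nat_recr n) //= E !ReImE.
  move: (Re _) (Im _) (Re _) (Im _) => s1 s2 s3 s4.
  by apply: quat_eqP; rewrite !qcoords; ring.
exact: (cvgD (cvgD (cvgD (cvgZr_tmp A1) (cvgZr_tmp A2)) (cvgZr_tmp B1)) (cvgZr_tmp B2)).
Qed.

End quat_alg.

(** * The star cosine and sine of a stem function *)

Section stem_trig.
Variable R : realType.
Implicit Types p q r I J : quat R.

Lemma ccvg_eq (u v : nat -> R[i]) l : u =1 v -> ccvg u l -> ccvg v l.
Proof. by move=> /funext ->. Qed.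

Lemma ccvg_shiftS (u : nat -> R[i]) l : ccvg (fun n => u n.+1) l -> ccvg u l.
Proof. by move=> [u1 u2]; split; [rewrite -(cvg_shiftS (fun n => Re (u n)))|
  rewrite -(cvg_shiftS (fun n => Im (u n)))]. Qed.

(** The eigenvalues of f_0 + f_v are f_0 + mu and f_0 - mu with mu^2 = - N.  If
    mu is nonzero, the coefficient of f_v in the n-th power is the divided
    difference of the n-th power between them; if mu = 0, it is the derivative of
    the n-th power at f_0.  Summing the series replaces powers by cosines and
    sines. *)
Lemma cos_sin_star_stem (f : quat R -> quat R) (z : R * R) (F0 F1 : quat R) :
  stem_on f z F0 F1 ->
  let p := qvec F0 in let r := qvec F1 in
  let f0 := qre F0 +i* qre F1 in
  exists Ac Bc As Bs : R[i],
  [/\ forall I, imag_sphere I ->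
        cos_star f (slice_pt I z) = stem0 p r Ac Bc + I * stem1 p r Ac Bc,
      forall I, imag_sphere I ->
        sin_star f (slice_pt I z) = stem0 p r As Bs + I * stem1 p r As Bs,
      qdisc F0 F1 = 0 ->
        [/\ Ac = ccos f0, As = csin f0, Bc = - csin f0 & Bs = ccos f0] &
      forall mu : R[i], mu ^+ 2 = - qdisc F0 F1 -> mu != 0 ->
        2 * mu * Bc = ccos (f0 + mu) - ccos (f0 - mu) /\
        2 * mu * Bs = csin (f0 + mu) - csin (f0 - mu)].
Proof.
move=> fE p r f0.
set N := qdisc F0 F1.
have main (a b : nat -> R[i]) Ac Bc As Bs : a 0%N = 1 -> b 0%N = 0 ->
    (forall n, a n.+1 = f0 * a n - N * b n) ->
    (forall n, b n.+1 = a n + f0 * b n) ->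
    ccvg (fun n => \sum_(0 <= k < n) ((-1) ^+ k / (2 * k)`!%:R)%:C * a (2 * k)%N) Ac ->
    ccvg (fun n => \sum_(0 <= k < n) ((-1) ^+ k / (2 * k)`!%:R)%:C * b (2 * k)%N) Bc ->
    ccvg (fun n => \sum_(0 <= k < n) ((-1) ^+ k / (2 * k).+1`!%:R)%:C * a (2 * k).+1) As ->
    ccvg (fun n => \sum_(0 <= k < n) ((-1) ^+ k / (2 * k).+1`!%:R)%:C * b (2 * k).+1) Bs ->
    (forall I, imag_sphere I ->
        cos_star f (slice_pt I z) = stem0 p r Ac Bc + I * stem1 p r Ac Bc) /\
    (forall I, imag_sphere I ->
        sin_star f (slice_pt I z) = stem0 p r As Bs + I * stem1 p r As Bs).
  move=> a0 b0 aS bS hAc hBc hAs hBs.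
  have sp := star_pow_stem fE a0 b0 aS bS.
  split=> I Is.
    rewrite /cos_star -(stem_series p r I hAc hBc); congr (limn (series _)).
    by apply/funext => k; rewrite (sp _ I Is).
  rewrite /sin_star -(stem_series p r I hAs hBs); congr (limn (series _)).
  by apply/funext => k; rewrite (sp _ I Is).
have [N0|N0] := eqVneq N 0.
  (* the nilpotent case: (f_0 + f_v)^n = f_0^n + n f_0^(n-1) f_v *)
  pose a n := f0 ^+ n; pose b n := n%:R * f0 ^+ n.-1.
  have bc : ccvg (fun n => \sum_(0 <= k < n)
      ((-1) ^+ k / (2 * k)`!%:R)%:C * b (2 * k)%N) (- csin f0).
    apply: ccvg_shiftS; rewrite -[- csin f0]mulN1r.
    apply: ccvg_eq (ccvgMr (-1) (csin_series f0)) => n.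
    rewrite big_nat_recl// {1}/b muln0 mul0r mulr0 add0r mulr_sumr.
    apply: eq_bigr => k _; rewrite /b mulnS add2n /= !mulrA; congr (_ * _).
    rewrite mulN1r -(rmorph_nat (real_complex R)) -rCM -(rmorphN (real_complex R)).
    congr (real_complex R _); rewrite [in RHS]factS natrM exprS.
    have h1 : (2 * k).+2%:R != 0 :> R by rewrite pnatr_eq0.
    have h2 : (2 * k).+1`!%:R != 0 :> R by rewrite pnatr_eq0 -lt0n fact_gt0.
    by rewrite invfM mulN1r !mulNr !mulrA [in RHS]mulrAC divfK.
  have bs : ccvg (fun n => \sum_(0 <= k < n)
      ((-1) ^+ k / (2 * k).+1`!%:R)%:C * b (2 * k).+1) (ccos f0).
    apply: ccvg_eq (ccos_series f0) => n.
    apply: eq_bigr => k _; rewrite /b /= mulrA; congr (_ * _).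
    rewrite -(rmorph_nat (real_complex R)) -rCM; congr (_%:C).
    have h1 : (2 * k).+1%:R != 0 :> R by rewrite pnatr_eq0.
    by rewrite factS natrM invfM !mulrA mulrAC divfK.
  have [||||h1 h2] := main a b _ _ _ _ _ _ _ _ (ccos_series f0) bc (csin_series f0) bs.
  - by rewrite /a expr0.
  - by rewrite /b mul0r.
  - by move=> n; rewrite /a exprS N0 mul0r subr0.
  - move=> n; rewrite /a /b /= -natr1; case: n => [|n]; first by rewrite !mul0r mulr0 addr0 add0r mul1r.
    by rewrite /= exprS; ring.
  exists (ccos f0), (- csin f0), (csin f0), (ccos f0); split=> //.
  move=> mu; rewrite N0 oppr0 => /eqP; rewrite sqrf_eq0 => /eqP ->.
  by rewrite eqxx.
pose mu := sqrtc (- N).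
have mu2 : mu ^+ 2 = - N by rewrite sqr_sqrtc.
have mu0 : mu != 0.
  by apply: contra_neq N0 => m0; rewrite -[N]opprK -mu2 m0 expr0n oppr0.
pose a n := 2^-1 * ((f0 + mu) ^+ n + (f0 - mu) ^+ n).
pose b n := (2 * mu)^-1 * ((f0 + mu) ^+ n - (f0 - mu) ^+ n).
have hser (c : nat -> R[i]) (m : nat -> nat) (l : R[i] -> R[i]) :
    (forall w, ccvg (fun n => \sum_(0 <= k < n) c k * w ^+ (m k)) (l w)) ->
    ccvg (fun n => \sum_(0 <= k < n) c k * a (m k))
       (2^-1 * (l (f0 + mu) + l (f0 - mu))) /\
    ccvg (fun n => \sum_(0 <= k < n) c k * b (m k))
       ((2 * mu)^-1 * (l (f0 + mu) + -1 * l (f0 - mu))).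
  move=> hl; split.
    apply: ccvg_eq (ccvgMr _ (ccvgD (hl _) (hl _))) => n.
    rewrite -big_split/= mulr_sumr; apply: eq_bigr => k _; rewrite /a; ring.
  apply: ccvg_eq (ccvgMr _ (ccvgD (hl _) (ccvgMr (-1) (hl _)))) => n.
  rewrite mulr_sumr -big_split/= mulr_sumr; apply: eq_bigr => k _; rewrite /b; ring.
have [c1 c2] := hser _ _ _ (@ccos_series R).
have [s1 s2] := hser _ _ _ (@csin_series R).
have [||||h1 h2] := main a b _ _ _ _ _ _ _ _ c1 c2 s1 s2.
- by rewrite /a !expr0 -mulr2n -mulr_natl mulr1 mulVf// pnatr_eq0.
- by rewrite /b !expr0 subrr mulr0.
- move=> n; rewrite /a /b -[N]opprK -mu2 !exprS.
  by move: ((f0 + mu) ^+ n) ((f0 - mu) ^+ n) => x y; field; rewrite mu0.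
- move=> n; rewrite /a /b !exprS.
  by move: ((f0 + mu) ^+ n) ((f0 - mu) ^+ n) => x y; field; rewrite mu0.
eexists; eexists; eexists; eexists; split; [exact: h1|exact: h2| |].
  by move=> N1; rewrite N1 eqxx in N0.
move=> nu nu2 nu0.
have : (nu - mu) * (nu + mu) = 0 by rewrite -subr_sqr nu2 mu2 subrr.
have m2 : 2 * mu != 0 by rewrite mulf_neq0// pnatr_eq0.
move/eqP; rewrite mulf_eq0 subr_eq0 addr_eq0 => /orP[] /eqP ->.
  by rewrite !mulVKf// !mulN1r.
rewrite opprK !mulN1r !mulrN !mulNr !mulVKf// !opprB; split; ring.
Qed.

End stem_trig.

Section stem_trig_values.
Variable R : realType.
Implicit Types p q r I J : quat R.

Definition slice_val I (w : R[i]) : quat R := slice_pt I (Re w, Im w).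

Definition qI : quat R := Quat 0 1 0 0.
Lemma qI_sphere : imag_sphere qI.
Proof. by apply/imag_sphereP; rewrite !qcoords; split=> //; ring. Qed.

Lemma qvec_real (x : R) : qvec (x%:A : quat R) = 0.
Proof. by apply: quat_eqP; rewrite !(qvecE, qcoords) ?mulr0. Qed.

Lemma qre_real (x : R) : qre (x%:A : quat R) = x.
Proof. by rewrite !qcoords mulr1. Qed.

Lemma scalar_cos_sin_star (f : quat R -> quat R) (z : R * R) (x y : R) :
  stem_on f z x%:A y%:A -> forall I, imag_sphere I ->
  cos_star f (slice_pt I z) = slice_val I (ccos (x +i* y)) /\
  sin_star f (slice_pt I z) = slice_val I (csin (x +i* y)).
Proof.
move=> fE I Is.
have [Ac [Bc [As [Bs [hc hs h0 _]]]]] := cos_sin_star_stem fE.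
rewrite hc// hs// /stem0 /stem1 !qvec_real !scaler0 !subr0 !addr0.
have [|-> -> _ _] := h0.
  by rewrite /qdisc !qcoords; apply: complex_eqP; rewrite !ReImE;
    [change (Re 0) with (0 : R)|change (Im 0) with (0 : R)]; ring.
by rewrite !qre_real /slice_val !slice_ptE /= -!scalerAr !mulr1.
Qed.

(** Evaluation at I and at - I separates the two components. *)
Lemma stem_unique p r p' r' :
  (forall I, imag_sphere I -> p + I * r = p' + I * r') -> p = p' /\ r = r'.
Proof.
move=> h; have h1 := h _ qI_sphere; have h2 := h _ (imag_sphereN qI_sphere).
have := (congr1 (@qre R) h1, congr1 (@qi R) h1, congr1 (@qj R) h1, congr1 (@qk R) h1).
have := (congr1 (@qre R) h2, congr1 (@qi R) h2, congr1 (@qj R) h2, congr1 (@qk R) h2).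
rewrite !qcoords => -[[[a1 a2] a3] a4] [[[b1 b2] b3] b4].
by split; apply: quat_eqP; lra.
Qed.

(** The scalar parts can be compared directly.  The vector part B f_v vanishes,
    and multiplying it by the conjugate of B shows that B or f_v does. *)
Lemma stem_ev_eq p r (A B C : R[i]) :
  qre p = 0 -> qre r = 0 ->
  (forall I, imag_sphere I -> stem0 p r A B + I * stem1 p r A B = slice_val I C) ->
  A = C /\ (B = 0 \/ (p = 0 /\ r = 0)).
Proof.
move=> p0 r0 h.
have [e0 e1] : stem0 p r A B = (Re C)%:A /\ stem1 p r A B = (Im C)%:A.
  by apply: stem_unique => I Is; rewrite h// /slice_val slice_ptE /= -scalerAr mulr1.
have a0 : Re A = Re C.
  by have := congr1 (@qre R) e0; rewrite /stem0 !qcoords p0 r0; lra.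
have a1 : Im A = Im C.
  by have := congr1 (@qre R) e1; rewrite /stem1 !qcoords p0 r0; lra.
split; first exact: complex_eqP.
have v0 : Re B *: p = Im B *: r.
  by apply/eqP; rewrite -subr_eq0 -(inj_eq (addrI (Re A)%:A)) addrA addr0 -/(stem0 p r A B) e0 a0.
have v1 : Re B *: r = - (Im B *: p).
  by apply/eqP; rewrite -addr_eq0 addrC -(inj_eq (addrI (Im A)%:A)) addrA addr0 -/(stem1 p r A B) e1 a1.
have w0 : (Re B ^+ 2 + Im B ^+ 2) *: p = 0.
  by rewrite !expr2 scalerDl -!scalerA v0 scalerA mulrC -scalerA v1 scalerN addNr.
have w1 : (Re B ^+ 2 + Im B ^+ 2) *: r = 0.
  by rewrite !expr2 scalerDl -!scalerA v1 -v0 scalerN scalerA mulrC -scalerA addNr.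
have [b|b] := eqVneq (Re B ^+ 2 + Im B ^+ 2) 0.
  left; have b1 := sqr_ge0 (Re B); have b2 := sqr_ge0 (Im B).
  by apply: complex_eqP; apply/eqP; rewrite -sqrf_eq0; apply/eqP; [change (Re 0) with (0 : R)|]; lra.
right; split; apply/eqP.
  by move/eqP: w0; rewrite scaler_eq0 (negbTE b).
by move/eqP: w1; rewrite scaler_eq0 (negbTE b).
Qed.

(** If f_v is not 0, both of its coefficients vanish.  For mu = 0 they are
    - sin f_0 and cos f_0, which have no common zero.  Otherwise f_0 + mu and
    f_0 - mu have the same cosine and sine, so 2 mu is a period 2 k pi with k
    nonzero, and N = - (k pi)^2. *)
Lemma scalar_or_far (f : quat R -> quat R) (z : R * R) (F0 F1 : quat R) (c s : R[i]) :
  stem_on f z F0 F1 ->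
  (forall I, imag_sphere I -> cos_star f (slice_pt I z) = slice_val I c) ->
  (forall I, imag_sphere I -> sin_star f (slice_pt I z) = slice_val I s) ->
  (qvec F0 = 0 /\ qvec F1 = 0) \/ Re (qdisc F0 F1) <= - pi ^+ 2.
Proof.
move=> fE hc hs.
have [Ac [Bc [As [Bs [hc' hs' h0 h1]]]]] := cos_sin_star_stem fE.
have vre p : qre (qvec p) = 0 by rewrite qvecE.
have [_ [Bc0|]] : Ac = c /\ (Bc = 0 \/ qvec F0 = 0 /\ qvec F1 = 0).
  by apply: stem_ev_eq => // I Is; rewrite -hc'// hc.
  have [_ [Bs0|]] : As = s /\ (Bs = 0 \/ qvec F0 = 0 /\ qvec F1 = 0).
    by apply: stem_ev_eq => // I Is; rewrite -hs'// hs.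
  right; have [N0|N0] := eqVneq (qdisc F0 F1) 0.
    have [_ _ e1 e2] := h0 N0.
    have := ccos2Dcsin2 (qre F0 +i* qre F1).
    rewrite -e2 Bs0 -[csin _]opprK -e1 Bc0 oppr0 expr0n /= addr0 => /eqP.
    by rewrite eq_sym oner_eq0.
  have [mu mu2] : exists mu : R[i], mu ^+ 2 = - qdisc F0 F1.
    by exists (sqrtc (- qdisc F0 F1)); rewrite sqr_sqrtc.
  have mu0 : mu != 0.
    by apply: contra_neq N0 => m0; rewrite -[qdisc _ _]opprK -mu2 m0 expr0n oppr0.
  have [e1 e2] := h1 mu mu2 mu0.
  move: e1 e2; rewrite Bc0 Bs0 !mulr0.
  move: (qre F0 +i* qre F1) => f0 => /esym/eqP; rewrite subr_eq0 => /eqP e1.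
  move/esym/eqP; rewrite subr_eq0 => /eqP e2.
  have : cexp (ci R * (f0 + mu)) = cexp (ci R * (f0 - mu)).
    by rewrite -!ccos_csin e1 e2.
  move=> /cexp_inj [r1 [k r2]].
  rewrite /ci !ReImE in r1 r2.
  have imu : Im mu = 0 by lra.
  have rmu : Re mu = k%:~R * pi by lra.
  have k0 : k != 0.
    apply: contraNneq mu0 => k0; apply/eqP; apply: complex_eqP => //.
    by rewrite rmu k0 mul0r.
  rewrite -[qdisc _ _]opprK -mu2 expr2 !ReImE imu mulr0 subr0 rmu lerN2.
  rewrite -expr2 exprMn -[leLHS]mul1r ler_wpM2r// ?sqr_ge0//.
  rewrite -rmorphXn ler1z.
  by rewrite -gtz0_ge1 exprn_even_gt0.
all: by move=> ?; left.
Qed.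

End stem_trig_values.

(** * Slice regular functions on a circular domain *)

Section plane.
Variables (R : realType) (Omega : set (quat R)).
Hypothesis circ : circular_domain Omega.
Local Notation D := (plane_of Omega).
Implicit Types (I J : quat R) (z : R * R).

Lemma slice_pt_circ I J z : imag_sphere I -> imag_sphere J ->
  Omega (slice_pt I z) -> Omega (slice_pt J z).
Proof. by move=> Is Js Oz; apply: (circ.2 _ Oz); exact: slice_pt_sphere. Qed.

Lemma planeP I z : imag_sphere I -> D z <-> Omega (slice_pt I z).
Proof.
move=> Is; split; last by exists I.
by move=> [J Js]; exact: slice_pt_circ.
Qed.

Lemma slice_of_plane I : imag_sphere I -> slice_of Omega I = D.
Proof. by move=> Is; apply/seteqP; split => z; rewrite (planeP _ Is). Qed.

Lemma plane_open : open D.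
Proof.
rewrite -(slice_of_plane (qI_sphere R)) /slice_of.
apply: open_comp; last by have [[]] := circ.
move=> z _; apply: cvgD.
  by apply: (@cvgZr_tmp _ _ _ _ _ fst z.1 (1 : quat R)); exact: cvg_fst.
by apply: (@cvgZr_tmp _ _ _ _ _ snd z.2 (qI R)); exact: cvg_snd.
Qed.

Lemma plane_conj z : D z -> D (z.1, - z.2).
Proof.
have Is := qI_sphere R; have Ns := imag_sphereN Is.
move=> /(planeP z Is) h; apply/(planeP _ Ns).
by rewrite slice_ptE /= scaleNr scalerN opprK.
Qed.

(** The point among z and its conjugate that lies in the closed upper half plane. *)
Definition fold_up z : R * R := (z.1, `|z.2|).

Lemma plane_fold_up z : D z -> D (fold_up z).
Proof.
move=> Dz; rewrite /fold_up; have [z0|z0] := leP 0 z.2.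
  by rewrite ger0_norm//; case: z Dz {z0}.
by rewrite ltr0_norm//; exact: plane_conj.
Qed.

(** Every quaternion is a point of a slice with nonnegative imaginary
    coordinate, so the upper half of the plane domain carries all of Omega. *)
Lemma slice_pt_repr q : Omega q ->
  exists I z, [/\ imag_sphere I, 0 <= z.2, D z & q = slice_pt I z].
Proof.
move=> Oq.
have [I [z [Is z0 qE]]] : exists I z, [/\ imag_sphere I, 0 <= z.2 & q = slice_pt I z].
  have n2 : qnorm2 (qvec q) = qi q ^+ 2 + qj q ^+ 2 + qk q ^+ 2.
    by rewrite /qnorm2 !qvecE expr0n /= add0r.
  have n0 : 0 <= qnorm2 (qvec q) by rewrite n2 !addr_ge0// sqr_ge0.
  have sq : qnorm (qvec q) ^+ 2 = qi q ^+ 2 + qj q ^+ 2 + qk q ^+ 2.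
    by rewrite /qnorm sqr_sqrtr.
  have [v0|v0] := eqVneq (qvec q) 0.
    exists (qI R), (qre q, 0); split=> //=; first exact: qI_sphere.
    by rewrite slice_ptE /= scale0r addr0 -[LHS](subrK (qre q)%:A) -/(qvec q) v0 add0r.
  have nz : qnorm (qvec q) != 0.
    by rewrite /qnorm sqrtr_eq0 -ltNge lt_neqAle n0 eq_sym qnorm2_eq0 v0.
  exists ((qnorm (qvec q))^-1 *: qvec q), (qre q, qnorm (qvec q)); split.
  - apply/imag_sphereP; rewrite !(qcoordZ, qvecE) mulr0; split=> //.
    by rewrite !exprMn -!mulrDr -sq -exprMn mulVf// expr1n.
  - exact: sqrtr_ge0.
  - by rewrite slice_ptE /= scalerA divff// scale1r /qvec addrC subrK.
exists I, z; split=> //; apply/(planeP _ Is); by rewrite -qE.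
Qed.

Lemma slice_regular_stem f : slice_regular Omega f ->
  exists F0 F1 : R * R -> quat R,
    [/\ C1_on D F0, C1_on D F1,
        forall z, D z -> F0 (z.1, - z.2) = F0 z /\ F1 (z.1, - z.2) = - F1 z,
        forall z, D z -> 'D_(1, 0) F0 z = 'D_(0, 1) F1 z /\
          'D_(0, 1) F0 z = - 'D_(1, 0) F1 z &
        forall z, D z -> stem_on f z (F0 z) (F1 z)].
Proof.
move=> [F0 [F1 [h1 h2 h3 h4 h5]]]; exists F0, F1; split=> // z Dz I Is.
by apply: h5 => //; apply/(planeP z Is).
Qed.

(** p + i r is a holomorphic function on the plane domain, symmetric under
    conjugation, whose evaluation on the slices is f. *)
Record real_stem (f : quat R -> quat R) (p r : R * R -> R) : Prop := RealStem {
  stem_C1 : rC1_on D p /\ rC1_on D r;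
  stem_sym : forall z, D z -> p (z.1, - z.2) = p z /\ r (z.1, - z.2) = - r z;
  stem_CR : forall z, D z -> 'D_(1, 0) p z = 'D_(0, 1) r z /\
    'D_(0, 1) p z = - 'D_(1, 0) r z;
  stem_val : forall z, D z -> stem_on f z (p z)%:A (r z)%:A }.

Lemma qre_lin (h : R) (a b : quat R) : qre (h *: (a - b)) = h *: (qre a - qre b).
Proof. by rewrite !qcoords. Qed.

Lemma qre_continuous : continuous (@qre R : quat R -> R).
Proof. by move=> q; exact: (@coord_continuous R 1 4 0 0 q). Qed.

Lemma qre_realK (q : quat R) : qi q = 0 -> qj q = 0 -> qk q = 0 -> (qre q)%:A = q.
Proof.
by move=> h1 h2 h3; apply: quat_eqP; rewrite !qcoords ?h1 ?h2 ?h3; ring.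
Qed.

Lemma real_stem_of_scalar f F0 F1 : C1_on D F0 -> C1_on D F1 ->
  (forall z, D z -> F0 (z.1, - z.2) = F0 z /\ F1 (z.1, - z.2) = - F1 z) ->
  (forall z, D z -> 'D_(1, 0) F0 z = 'D_(0, 1) F1 z /\
          'D_(0, 1) F0 z = - 'D_(1, 0) F1 z) ->
  (forall z, D z -> stem_on f z (F0 z) (F1 z)) ->
  (forall z, D z -> (qre (F0 z))%:A = F0 z /\ (qre (F1 z))%:A = F1 z) ->
  real_stem f (@qre R \o F0) (@qre R \o F1).
Proof.
move=> C0 C1 sy cr st rl.
have [q0 d0] := coord_C1_on plane_open qre_lin qre_continuous C0.
have [q1 d1] := coord_C1_on plane_open qre_lin qre_continuous C1.
split=> //.
- by move=> z Dz /=; have [-> ->] := sy z Dz; rewrite !qcoords.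
- move=> z Dz; have [-> ->] := d0 z Dz; have [-> ->] := d1 z Dz.
  by have [-> ->] := cr z Dz; rewrite !qcoords.
- by move=> z Dz I Is /=; have [-> ->] := rl z Dz; exact: st.
Qed.

(** The values at I and at - I lie in the slice of I, hence so do both
    components; the slices of i and of j meet in the real line only. *)
Lemma slice_preserving_stem f : slice_preserving_regular Omega f ->
  exists p r, real_stem f p r.
Proof.
move=> [/slice_regular_stem[F0 [F1 [C0 C1 sy cr st]]] pr].
exists (@qre R \o F0), (@qre R \o F1); apply: real_stem_of_scalar => // z Dz.
pose qJ : quat R := Quat 0 0 1 0.
have Js : imag_sphere qJ by apply/imag_sphereP; rewrite !qcoords; split=> //; ring.
have inC I : imag_sphere I -> exists a b, F0 z + I * F1 z = a%:A + b *: I.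
  move=> Is; have im : (f @` (Omega `&` C_slice I)) (f (slice_pt I z)).
    exists (slice_pt I z) => //; split; last by exists z.
    exact/(planeP z Is).
  have [w _ e] := pr I Is _ im.
  by exists w.1, w.2; rewrite -st// -e.
have Is := qI_sphere R.
have [a1 [b1 e1]] := inC _ Is; have [a2 [b2 e2]] := inC _ (imag_sphereN Is).
have [a3 [b3 e3]] := inC _ Js; have [a4 [b4 e4]] := inC _ (imag_sphereN Js).
have := (congr1 (@qj R) e1, congr1 (@qk R) e1, congr1 (@qj R) e2, congr1 (@qk R) e2).
have := (congr1 (@qi R) e3, congr1 (@qk R) e3, congr1 (@qi R) e4, congr1 (@qk R) e4).
rewrite /qI /qJ !qcoords => -[[[x1 x2] x3] x4] [[[y1 y2] y3] y4].
by split; apply: qre_realK; lra.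
Qed.

(** Evaluate at q with z = (Re q, |q_v|) and I = q_v / |q_v|.  At real q this
    divides by zero, but there r vanishes by symmetry and so does the term. *)
Lemma real_stem_regular (p r : R * R -> R) :
  rC1_on D p -> rC1_on D r ->
  (forall z, D z -> p (z.1, - z.2) = p z /\ r (z.1, - z.2) = - r z) ->
  (forall z, D z -> 'D_(1, 0) p z = 'D_(0, 1) r z /\ 'D_(0, 1) p z = - 'D_(1, 0) r z) ->
  exists f, slice_preserving_regular Omega f /\
    forall z, D z -> stem_on f z (p z)%:A (r z)%:A.
Proof.
move=> pC rC sy cr.
pose zq (q : quat R) := (qre q, qnorm (qvec q)).
pose f q : quat R := (p (zq q))%:A + (r (zq q) / qnorm (qvec q)) *: qvec q.
exists f.
have st z : D z -> stem_on f z (p z)%:A (r z)%:A.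
  move=> Dz I Is; have [e1 [e2 e3]] := slice_pt_proj z Is.
  rewrite /f /zq e1 e2 e3 scalerA -scalerAr mulr1.
  have [s1 s2] := sy z Dz; have [z0|z0|z0] := ltgtP z.2 0.
  - rewrite ltr0_norm// s1 s2; congr (_ + _ *: _).
    by rewrite invrN mulrNN divfK// lt_eqF.
  - rewrite gtr0_norm// -surjective_pairing; congr (_ + _ *: _).
    by rewrite divfK// gt_eqF.
  - have zz : (z.1, - z.2) = z by rewrite [RHS]surjective_pairing z0 oppr0.
    rewrite zz in s2; have -> : r z = 0 by lra.
    by rewrite z0 normr0 mulr0 -[in (z.1, 0)]z0 -surjective_pairing.
split=> //.
have [pc pd] := C1_on_real plane_open pC; have [rc rd] := C1_on_real plane_open rC.
split.
  exists (fun z => (p z)%:A), (fun z => (r z)%:A); split; [exact: pc|exact: rc| | |].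
  - by move=> z Dz /=; have [-> ->] := sy z Dz; rewrite scaleNr.
  - move=> z Dz; have [-> ->] := pd z Dz; have [-> ->] := rd z Dz.
    by have [-> ->] := cr z Dz; rewrite scaleNr.
  - by move=> I z Is Oz; apply: st => //; exists I.
move=> I Is _ [q [Oq [z _ zq']] <-].
rewrite -zq' st//; last by apply/(planeP z Is); rewrite zq'.
by exists (p z, r z) => //; rewrite slice_ptE /= -scalerAr mulr1.
Qed.

End plane.

(** * The logarithm of a_0 + i a_1 *)

Section slice_logarithm.
Variables (R : realType) (Omega : set (quat R)).
Hypothesis circ : circular_domain Omega.
Local Notation D := (plane_of Omega).
Implicit Types (I J : quat R) (z : R * R).

Lemma slice_val_inj (a b : R[i]) :
  (forall I, imag_sphere I -> slice_val I a = slice_val I b) -> a = b.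
Proof.
move=> h; have := h _ (qI_sphere R); rewrite /slice_val !slice_ptE /= => e.
have := (congr1 (@qre R) e, congr1 (@qi R) e); rewrite /qI !qcoords => -[e1 e2].
by apply: complex_eqP; lra.
Qed.

Lemma stem_slice_val f z x y I : stem_on f z x%:A y%:A -> imag_sphere I ->
  f (slice_pt I z) = slice_val I (x +i* y).
Proof. by move=> h Is; rewrite h// /slice_val slice_ptE -scalerAr mulr1. Qed.

(** Below, A0 + i B0 and A1 + i B1 are the stem functions of a0 and a1, and
    h = u + i v is (A0 + i B0) + i (A1 + i B1). *)
Variables a0 a1 : quat R -> quat R.
Hypothesis a01 : {in Omega, forall q, a0 q ^+ 2 + a1 q ^+ 2 = 1}.
Variables A0 B0 A1 B1 : R * R -> R.
Hypotheses (st0 : real_stem Omega a0 A0 B0) (st1 : real_stem Omega a1 A1 B1).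

Lemma stems_unit z : D z ->
  A0 z ^+ 2 - B0 z ^+ 2 + A1 z ^+ 2 - B1 z ^+ 2 = 1 /\ A0 z * B0 z + A1 z * B1 z = 0.
Proof.
move=> Dz; have Is := qI_sphere R.
have Oz : Omega (slice_pt (qI R) z) by apply/(planeP circ z Is).
have := a01 (mem_set Oz).
rewrite (stem_val st0 Dz Is) (stem_val st1 Dz Is) !expr2 => e.
have := (congr1 (@qre R) e, congr1 (@qi R) e); rewrite /qI !qcoords => -[e1 e2].
by split; lra.
Qed.

Let u z := A0 z - B1 z.
Let v z := B0 z + A1 z.
Let rho z := u z ^+ 2 + v z ^+ 2.

(** The second factor is the squared modulus of the inverse
    (A0 + i B0) - i (A1 + i B1) of h. *)
Lemma rho_mul_inverse z : D z ->
  rho z * ((A0 z + B1 z) ^+ 2 + (B0 z - A1 z) ^+ 2) = 1.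
Proof.
move=> /stems_unit[e1 e2].
transitivity ((A0 z ^+ 2 - B0 z ^+ 2 + A1 z ^+ 2 - B1 z ^+ 2) ^+ 2 +
  4 * (A0 z * B0 z + A1 z * B1 z) ^+ 2); first by rewrite /rho /u /v; ring.
by rewrite e1 e2; ring.
Qed.

Lemma rho_neq0 z : D z -> rho z != 0.
Proof.
by move=> /rho_mul_inverse; apply: contra_eq_neq => ->; rewrite mul0r eq_sym oner_neq0.
Qed.

Lemma rho_gt0 z : D z -> 0 < rho z.
Proof. by move=> Dz; rewrite lt_neqAle eq_sym rho_neq0// addr_ge0// sqr_ge0. Qed.

(** The symmetry of the stem functions says h (conj z) = 1 / conj (h z), which
    is h z divided by its squared modulus rho z. *)
Lemma uv_conj z : D z ->
  [/\ u (z.1, - z.2) = u z / rho z, v (z.1, - z.2) = v z / rho z &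
      rho (z.1, - z.2) = (rho z)^-1].
Proof.
move=> Dz; have [e1 e2] := stems_unit Dz.
have r0 := rho_neq0 Dz.
have [s1 s2] := stem_sym st0 Dz; have [s3 s4] := stem_sym st1 Dz.
have eu : u (z.1, - z.2) = u z / rho z.
  apply: (mulIf r0); rewrite divfK// /rho /u /v s1 s4 opprK.
  rewrite -[RHS]mulr1 -e1.
  transitivity ((A0 z - B1 z) * (A0 z ^+ 2 - B0 z ^+ 2 + A1 z ^+ 2 - B1 z ^+ 2) +
     2 * (B0 z + A1 z) * (A0 z * B0 z + A1 z * B1 z)); first by ring.
  by rewrite e2 mulr0 addr0.
have ev : v (z.1, - z.2) = v z / rho z.
  apply: (mulIf r0); rewrite divfK// /rho /u /v s2 s3.
  rewrite -[RHS]mulr1 -e1.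
  transitivity ((B0 z + A1 z) * (A0 z ^+ 2 - B0 z ^+ 2 + A1 z ^+ 2 - B1 z ^+ 2) -
     2 * (A0 z - B1 z) * (A0 z * B0 z + A1 z * B1 z)); first by ring.
  by rewrite e2 mulr0 subr0.
split=> //; rewrite {1}/rho eu ev !exprMn -mulrDl -/(rho z) expr2 mulrA divff//.
by rewrite mul1r.
Qed.

Let C z := u z / Num.sqrt (rho z).
Let S z := v z / Num.sqrt (rho z).

(** Dividing by rho z > 0 does not change the direction of h z. *)
Lemma CS_conj z : D z -> C (z.1, - z.2) = C z /\ S (z.1, - z.2) = S z.
Proof.
move=> Dz; have [eu ev er] := uv_conj Dz.
have r0 := rho_gt0 Dz.
have s0 : Num.sqrt (rho z) != 0 by rewrite sqrtr_eq0 -ltNge.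
have E : (rho z)^-1 / Num.sqrt (rho (z.1, - z.2)) = (Num.sqrt (rho z))^-1.
  rewrite er sqrtrV ?ltW// invrK -[in X in X^-1 * _](sqr_sqrtr (ltW r0)) expr2 invfM.
  by rewrite -mulrA mulVf// mulr1.
by rewrite /C /S eu ev -!mulrA E.
Qed.

Lemma CS_fold_up z : D z -> C (fold_up z) = C z /\ S (fold_up z) = S z.
Proof.
move=> Dz; rewrite /fold_up; have [z0|z0] := leP 0 z.2.
  by rewrite ger0_norm// -surjective_pairing.
by rewrite ltr0_norm//; exact: CS_conj.
Qed.

Lemma CS_unit z : D z -> C z ^+ 2 + S z ^+ 2 = 1.
Proof.
move=> Dz; have r0 := rho_gt0 Dz.
rewrite /C /S !exprMn -mulrDl -/(rho z) exprVn sqr_sqrtr ?ltW// divff//.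
exact: rho_neq0.
Qed.

Lemma rC1_lin (f g : R * R -> R) (c : R) : rC1_on D f -> rC1_on D g ->
  rC1_on D (fun z => f z + c * g z) /\
  forall z, D z ->
    'D_(1, 0) (fun z => f z + c * g z) z = 'D_(1, 0) f z + c * 'D_(1, 0) g z /\
    'D_(0, 1) (fun z => f z + c * g z) z = 'D_(0, 1) f z + c * 'D_(0, 1) g z.
Proof.
move=> fC gC.
have H (z w : R * R) : derivable f z w -> derivable g z w ->
    is_derive z w (fun z => f z + c * g z) ('D_w f z + c * 'D_w g z).
  by move=> /derivableP fd /derivableP gd; exact: (is_deriveD fd (is_deriveZ c gd)).
split=> [|z Dz]; last first.
  have [f1 f2 _ _] := fC z Dz; have [g1 g2 _ _] := gC z Dz.
  by split; [have [_ ->] := H _ _ f1 g1|have [_ ->] := H _ _ f2 g2].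
apply: (@rC1_of _ _ (plane_open circ) _
  (fun z => 'D_(1, 0) f z + c * 'D_(1, 0) g z)
  (fun z => 'D_(0, 1) f z + c * 'D_(0, 1) g z)) => z Dz;
    have [f1 f2 f3 f4] := fC z Dz; have [g1 g2 g3 g4] := gC z Dz.
  by split; [exact: H _ _ f1 g1|exact: H _ _ f2 g2].
split; first exact: (cvgD f3 (cvgM (cvg_cst c) g3)).
exact: (cvgD f4 (cvgM (cvg_cst c) g4)).
Qed.

Lemma u_lin : u = fun z => A0 z + (-1) * B1 z.
Proof. by apply/funext => z; rewrite mulN1r. Qed.
Lemma v_lin : v = fun z => B0 z + 1 * A1 z.
Proof. by apply/funext => z; rewrite mul1r. Qed.

Lemma u_C1 : rC1_on D u.
Proof.
by rewrite u_lin; exact: (rC1_lin (-1) (stem_C1 st0).1 (stem_C1 st1).2).1.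
Qed.
Lemma v_C1 : rC1_on D v.
Proof.
by rewrite v_lin; exact: (rC1_lin 1 (stem_C1 st0).2 (stem_C1 st1).1).1.
Qed.

Lemma uv_CR z : D z -> 'D_(1, 0) u z = 'D_(0, 1) v z /\ 'D_(0, 1) u z = - 'D_(1, 0) v z.
Proof.
move=> Dz; rewrite u_lin v_lin.
have [e1 e2] := (rC1_lin (-1) (stem_C1 st0).1 (stem_C1 st1).2).2 z Dz.
have [e3 e4] := (rC1_lin 1 (stem_C1 st0).2 (stem_C1 st1).1).2 z Dz.
have [c1 c2] := stem_CR st0 Dz; have [c3 c4] := stem_CR st1 Dz.
by rewrite e1 e2 e3 e4 c1 c2 c3 c4; split; ring.
Qed.

Lemma u_continuous z : D z -> {for z, continuous u}.
Proof. exact: rC1_continuous (plane_open circ) u_C1 z. Qed.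
Lemma v_continuous z : D z -> {for z, continuous v}.
Proof. exact: rC1_continuous (plane_open circ) v_C1 z. Qed.

Lemma CS_continuous z : D z -> {for z, continuous C} /\ {for z, continuous S}.
Proof.
move=> Dz.
have sc : {for z, continuous (fun z => (Num.sqrt (rho z))^-1)}.
  apply: cvgV; first by rewrite sqrtr_eq0 -ltNge rho_gt0.
  apply: (@continuous_comp _ _ _ rho Num.sqrt); last exact: sqrt_continuous.
  exact: (cvgD (cvgM (u_continuous Dz) (u_continuous Dz)) (cvgM (v_continuous Dz) (v_continuous Dz))).
by split; [exact: (cvgM (u_continuous Dz) sc)|exact: (cvgM (v_continuous Dz) sc)].
Qed.

(** With exp(i w) = h and exp(- i w) = 1 / h, the cosine and the sine of w are
    the half sum and, up to 1 / i, the half difference of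
    (A0 + i B0) + i (A1 + i B1) and (A0 + i B0) - i (A1 + i B1). *)
Lemma ccos_csin_of_arg z g : D z -> cos g = C z -> sin g = S z ->
  ccos (g +i* lnmod u v z) = A0 z +i* B0 z /\
  csin (g +i* lnmod u v z) = A1 z +i* B1 z.
Proof.
move=> Dz cg sg; have r0 := rho_gt0 Dz.
set w := g +i* _.
have er : expR (- lnmod u v z) = Num.sqrt (rho z).
  rewrite /lnmod opprK -[RHS]ger0_norm ?sqrtr_ge0// -[RHS]sqrtr_sqr.
  rewrite -[LHS]ger0_norm ?expR_ge0// -sqrtr_sqr; congr Num.sqrt.
  rewrite sqr_sqrtr ?ltW// expr2 -expRD -splitr.
  by rewrite lnK.
have s0 : Num.sqrt (rho z) != 0 by rewrite sqrtr_eq0 -ltNge.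
have eh : cexp (ci R * w) = u z +i* v z.
  have e1 : Re (ci R * w) = - lnmod u v z by rewrite /ci /w !ReImE; ring.
  have e2 : Im (ci R * w) = g by rewrite /ci /w !ReImE; ring.
  apply: complex_eqP.
    by rewrite Re_cexp e1 e2 er cg mulrC divfK.
  by rewrite Im_cexp e1 e2 er sg mulrC divfK.
have ep : (u z +i* v z) * ((A0 z + B1 z) +i* (B0 z - A1 z)) = 1.
  have [e1 e2] := stems_unit Dz.
  apply: complex_eqP; rewrite !ReImE /u /v.
    change (Re (1 : R[i])) with (1 : R); rewrite -e1; ring.
  change (Im (1 : R[i])) with (0 : R).
  transitivity (2 * (A0 z * B0 z + A1 z * B1 z)); [ring|by rewrite e2 mulr0].
have em : cexp (- (ci R * w)) = (A0 z + B1 z) +i* (B0 z - A1 z).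
  have h := cexp_mulN (ci R * w); rewrite eh in h.
  have n0 : u z +i* v z != 0.
    by apply: contra_eq_neq h => ->; rewrite mul0r eq_sym oner_neq0.
  by apply: (mulfI n0); rewrite h ep.
have h2 : (2 : R[i])^-1 = 2^-1 +i* 0.
  by rewrite -(rmorph_nat (real_complex R)) -fmorphV.
rewrite /ccos /csin eh em h2; split; apply: complex_eqP;
  by rewrite /ci !ReImE /u /v; field.
Qed.

Lemma fold_up_continuous z : {for z, continuous (@fold_up R)}.
Proof.
apply: (@pair_continuous _ _ _ fst (fun z : R * R => `|z.2|)); first exact: cvg_fst.
by apply: (@continuous_comp _ _ _ snd (fun x : R => `|x|)); [exact: cvg_snd|exact: norm_continuous].
Qed.

(** E stands for the whole plane domain of a slice domain, and for the upper
    half of the plane domain of a product domain. *)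
Variable E : set (R * R).
Hypotheses (sE : simply_connected_domain E) (ED : E `<=` D)
  (fold_upE : forall z, D z -> E (fold_up z)).

(** The angle found on E is pulled back along the folding, which does not change
    the direction of h. *)
Lemma even_arg : exists g : R * R -> R, forall z, D z ->
  [/\ {for z, continuous g}, cos (g z) = C z, sin (g z) = S z & g (z.1, - z.2) = g z].
Proof.
have [dE pE lE] := sE.
have [|||g hg] := @angle_lift R E C S _ _ _ dE pE lE.
- by move=> z /ED /CS_continuous[].
- by move=> z /ED /CS_continuous[].
- by move=> z /ED /CS_unit.
exists (g \o @fold_up R) => z Dz; have [g1 g2 g3] := hg _ (fold_upE Dz).
have [c1 s1] := CS_fold_up Dz.
split; [|by rewrite /= g2|by rewrite /= g3|by rewrite /= /fold_up normrN].
by apply: continuous_comp; [exact: fold_up_continuous|exact: g1].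
Qed.

Lemma gamma_exists : exists gamma g,
  [/\ slice_preserving_regular Omega gamma,
      forall z, D z -> stem_on gamma z (g z)%:A (lnmod u v z)%:A,
      forall z, D z -> {for z, continuous g} &
      forall z, D z -> cos (g z) = C z /\ sin (g z) = S z].
Proof.
have [g hg] := even_arg.
have gc z : D z -> {for z, continuous g} by move=> /hg[].
have gC z : D z -> cos (g z) = C z by move=> /hg[].
have gS z : D z -> sin (g z) = S z by move=> /hg[].
have [g1 g2] := lnmod_arg_rC1 (plane_open circ) u_C1 v_C1 rho_neq0 gc gC gS.
have g3 := lnmod_arg_CR (plane_open circ) u_C1 v_C1 rho_neq0 gc gC gS uv_CR.
have sy z : D z -> g (z.1, - z.2) = g z /\ lnmod u v (z.1, - z.2) = - lnmod u v z.
  move=> Dz; have [_ _ _ ->] := hg z Dz; split=> //.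
  have [_ _ er] := uv_conj Dz.
  by rewrite /lnmod -/(rho _) er lnV ?posrE ?rho_gt0// mulNr.
have [gamma [h1 h2]] := real_stem_regular circ g1 g2 sy g3.
exists gamma, g; split => // z Dz; by split; [exact: gC|exact: gS].
Qed.

Variables (gamma : quat R -> quat R) (g : R * R -> R).
Hypotheses (gst : forall z, D z -> stem_on gamma z (g z)%:A (lnmod u v z)%:A)
  (gc : forall z, D z -> {for z, continuous g})
  (gCS : forall z, D z -> cos (g z) = C z /\ sin (g z) = S z).

Lemma gamma_cos_sin :
  {in Omega, cos_star gamma =1 a0} /\ {in Omega, sin_star gamma =1 a1}.
Proof.
have H q : q \in Omega -> cos_star gamma q = a0 q /\ sin_star gamma q = a1 q.
  rewrite inE => /(slice_pt_repr circ)[I [z [Is _ Dz ->]]].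
  have [-> ->] := scalar_cos_sin_star (gst Dz) Is.
  have [cg sg] := gCS Dz; have [-> ->] := ccos_csin_of_arg Dz cg sg.
  by rewrite (stem_slice_val (stem_val st0 Dz) Is) (stem_slice_val (stem_val st1 Dz) Is).
by split=> q /H[].
Qed.

(** Equal cosines and sines mean equal exponentials: the imaginary parts of the
    stem functions agree, and the real parts differ by a continuous function with
    values in 2 pi Z on the connected set E. *)
Lemma gamma_unique gamma' (p r : R * R -> R) :
  (forall z, E z -> stem_on gamma' z (p z)%:A (r z)%:A) ->
  (forall z, E z -> {for z, continuous p}) ->
  {in Omega, cos_star gamma' =1 a0} -> {in Omega, sin_star gamma' =1 a1} ->
  exists k : int, {in Omega, forall q, gamma' q = gamma q + (2 * k%:~R * pi)%:A}.
Proof.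
move=> g'st pc cg' sg'.
have eq z : E z -> r z = lnmod u v z /\ exists k : int, p z = g z + 2 * k%:~R * pi.
  move=> Ez; have Dz := ED Ez.
  have [cg sg] := gCS Dz; have [cc cs] := ccos_csin_of_arg Dz cg sg.
  have Oz I : imag_sphere I -> slice_pt I z \in Omega.
    by move=> Is; rewrite inE; apply/(planeP circ z Is).
  have c1 : ccos (p z +i* r z) = ccos (g z +i* lnmod u v z).
    apply: slice_val_inj => I Is; rewrite cc -(stem_slice_val (stem_val st0 Dz) Is).
    by rewrite -cg'; [have [-> _] := scalar_cos_sin_star (g'st _ Ez) Is|exact: Oz].
  have s1 : csin (p z +i* r z) = csin (g z +i* lnmod u v z).
    apply: slice_val_inj => I Is; rewrite cs -(stem_slice_val (stem_val st1 Dz) Is).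
    by rewrite -sg'; [have [_ ->] := scalar_cos_sin_star (g'st _ Ez) Is|exact: Oz].
  have : cexp (ci R * (p z +i* r z)) = cexp (ci R * (g z +i* lnmod u v z)).
    by rewrite -!ccos_csin c1 s1.
  move=> /cexp_inj[]; rewrite /ci !ReImE => e1 [k e2].
  by split; [lra|exists k; lra].
have [[[z0 Ez0] _ cE] _ _] := sE.
have [_ [k ek]] := eq z0 Ez0.
exists k => q; rewrite inE => /(slice_pt_repr circ)[I [z [Is z0' Dz ->]]].
have Ez : E z.
  by have := fold_upE Dz; rewrite /fold_up ger0_norm// -surjective_pairing.
rewrite (g'st _ Ez I Is) (gst Dz Is).
have [-> _] := eq z Ez.
suff -> : p z = g z + 2 * k%:~R * pi by rewrite scalerDl addrAC.
have := @lift_unique _ _ E p g cE pc _ _ _ z z0 Ez Ez0.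
rewrite ek => H; have : p z - g z = g z0 + 2 * k%:~R * pi - g z0.
  apply: H => x Ex; first exact: gc (ED Ex).
    by have [_ [l ->]] := eq x Ex; rewrite cosD2pi_int.
  by have [_ [l ->]] := eq x Ex; rewrite sinD2pi_int.
by move=> h; rewrite -[LHS](subrK (g z)) h; ring.
Qed.

(** Re N avoids the values between - pi^2 and 0, and it is nonnegative at a real
    point because F1 vanishes there; its image being an interval, it never reaches
    - pi^2. *)
Lemma slice_regular_scalar gamma' F0 F1 : connected D ->
  C1_on D F0 -> C1_on D F1 ->
  (forall z, D z -> F0 (z.1, - z.2) = F0 z /\ F1 (z.1, - z.2) = - F1 z) ->
  (forall z, D z -> stem_on gamma' z (F0 z) (F1 z)) ->
  {in Omega, cos_star gamma' =1 a0} -> {in Omega, sin_star gamma' =1 a1} ->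
  slice_domain Omega ->
  forall z, D z -> (qre (F0 z))%:A = F0 z /\ (qre (F1 z))%:A = F1 z.
Proof.
move=> cD C0 C1 sy st cg' sg' [q0 [Oq0 [x _ xE]]].
pose N z := Re (qdisc (F0 z) (F1 z)).
have far z : D z -> (qvec (F0 z) = 0 /\ qvec (F1 z) = 0) \/ N z <= - pi ^+ 2.
  move=> Dz; apply: (@scalar_or_far R gamma' z _ _ (A0 z +i* B0 z) (A1 z +i* B1 z)) => [|I Is|I Is].
  - exact: st.
  - by rewrite cg' ?(stem_slice_val (stem_val st0 Dz) Is)// inE; apply/(planeP circ z Is).
  - by rewrite sg' ?(stem_slice_val (stem_val st1 Dz) Is)// inE; apply/(planeP circ z Is).
have scal z : D z -> ~ N z <= - pi ^+ 2 ->
    (qre (F0 z))%:A = F0 z /\ (qre (F1 z))%:A = F1 z.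
  move=> Dz nN; have [[e0 e1]|//] := far z Dz.
  by split; apply/esym; apply/eqP; rewrite -subr_eq0; apply/eqP.
have coordc (L : quat R -> R) (F : R * R -> quat R) z :
    (forall (h : R) a b, L (h *: (a - b)) = h *: (L a - L b)) -> continuous L ->
    C1_on D F -> D z -> {for z, continuous (L \o F)}.
  move=> Ll Lc FC Dz.
  exact: (rC1_continuous (plane_open circ) (coord_C1_on (plane_open circ) Ll Lc FC).1 Dz).
have qil (h : R) (a b : quat R) : qi (h *: (a - b)) = h *: (qi a - qi b) by rewrite !qcoords.
have qjl (h : R) (a b : quat R) : qj (h *: (a - b)) = h *: (qj a - qj b) by rewrite !qcoords.
have qkl (h : R) (a b : quat R) : qk (h *: (a - b)) = h *: (qk a - qk b) by rewrite !qcoords.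
have qic : continuous (@qi R : quat R -> R) by move=> q; exact: (@coord_continuous R 1 4 0 1 q).
have qjc : continuous (@qj R : quat R -> R) by move=> q; exact: (@coord_continuous R 1 4 0 2 q).
have qkc : continuous (@qk R : quat R -> R) by move=> q; exact: (@coord_continuous R 1 4 0 3 q).
have Nc z : D z -> {for z, continuous N}.
  move=> Dz.
  have sqc (F : R * R -> quat R) : C1_on D F ->
      {for z, continuous (fun z => qi (F z) ^+ 2 + qj (F z) ^+ 2 + qk (F z) ^+ 2)}.
    move=> FC.
    have ci := coordc _ _ z qil qic FC Dz; have cj := coordc _ _ z qjl qjc FC Dz.
    have ck := coordc _ _ z qkl qkc FC Dz.
    exact: (cvgD (cvgD (cvgM ci ci) (cvgM cj cj)) (cvgM ck ck)).
  exact: (cvgB (sqc _ C0) (sqc _ C1)).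
have /connected_intervalP itv : connected (N @` D).
  apply: connected_continuous_connected => //.
  by apply: continuous_in_subspaceT => z; rewrite inE; exact: Nc.
have Dx : D (x, 0).
  have Is := qI_sphere R; apply/(planeP circ _ Is).
  by rewrite slice_ptE /= scale0r addr0 xE.
have Nx : 0 <= N (x, 0).
  have [_ e] := sy _ Dx; rewrite /= oppr0 in e.
  have h (L : quat R -> R) : L (- F1 (x, 0)) = - L (F1 (x, 0)) -> L (F1 (x, 0)) = 0.
    by rewrite -e => h; lra.
  rewrite /N /qdisc Re_C (h _ (qcoordN _).1.1.2) (h _ (qcoordN _).1.2) (h _ (qcoordN _).2).
  by rewrite expr0n /= !addr0 subr0 !addr_ge0// sqr_ge0.
have pi0 := pi_gt0 R.
have pi20 : 0 < (pi : R) ^+ 2 by rewrite exprn_gt0.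
move=> z Dz; apply: scal => // Nz.
(* otherwise the value - pi^2 / 2 would be attained *)
have [y Dy Ny] : (N @` D) (- (pi ^+ 2) / 2).
  apply: (itv (N z) (N (x, 0))); [by exists z|by exists (x, 0)|].
  by apply/andP; split; lra.
have [[e0 e1]|] := far y Dy; last by rewrite Ny; lra.
move: Ny; rewrite /N /qdisc Re_C.
have v0 (q : quat R) : qvec q = 0 -> [/\ qi q = 0, qj q = 0 & qk q = 0].
  by move=> e; rewrite -[qi q](qvecE q).1.1.2 -[qj q](qvecE q).1.2 -[qk q](qvecE q).2 e !qcoord0.
have [-> -> ->] := v0 _ e0; have [-> -> ->] := v0 _ e1.
by rewrite expr0n /= !addr0 subr0; lra.
Qed.

End slice_logarithm.

(** * The theorem *)

Theorem proposition4p6 (R : realType) (Omega : set (quat R))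
    (Omega_circular : circular_domain Omega)
    (Omega_contractible : slice_contractible Omega)
    (a0 a1 : quat R -> quat R)
    (a0_reg : slice_preserving_regular Omega a0)
    (a1_reg : slice_preserving_regular Omega a1)
    (a01 : {in Omega, forall q, a0 q ^+ 2 + a1 q ^+ 2 = 1}) :
  exists gamma : quat R -> quat R,
    [/\ slice_preserving_regular Omega gamma,
        {in Omega, cos_star gamma =1 a0},
        {in Omega, sin_star gamma =1 a1},
        slice_domain Omega ->
          forall gamma' : quat R -> quat R,
            slice_regular Omega gamma' ->
            {in Omega, cos_star gamma' =1 a0} ->
            {in Omega, sin_star gamma' =1 a1} ->
            exists k : int,
              {in Omega, forall q, gamma' q = gamma q + (2 * k%:~R * pi)%:A} &
        product_domain Omega ->
          forall gamma' : quat R -> quat R,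
            slice_preserving_regular Omega gamma' ->
            {in Omega, cos_star gamma' =1 a0} ->
            {in Omega, sin_star gamma' =1 a1} ->
            exists k : int,
              {in Omega, forall q, gamma' q = gamma q + (2 * k%:~R * pi)%:A}].
Proof.
have [A0 [B0 st0]] := slice_preserving_stem Omega_circular a0_reg.
have [A1 [B1 st1]] := slice_preserving_stem Omega_circular a1_reg.
have [I Is [cs cp]] := Omega_contractible.
rewrite (slice_of_plane Omega_circular Is) in cs.
rewrite /half_slice_of (slice_of_plane Omega_circular Is) in cp.
have [E [sE ED fold_upE Eslice]] : exists E, [/\ simply_connected_domain E,
    E `<=` plane_of Omega, forall z, plane_of Omega z -> E (fold_up z) &
    slice_domain Omega -> E = plane_of Omega].
  have [sl|nsl] := pselect (slice_domain Omega).
    exists (plane_of Omega); split => //; first exact: cs.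
    by move=> z; exact: plane_fold_up.
  exists (plane_of Omega `&` [set z | 0 <= z.2]); split => //.
  - apply: cp; apply/eqP; apply: contra_notT nsl => /set0P; exact.
  - move=> z Dz; split; first exact: plane_fold_up.
    exact: normr_ge0.
have [gamma [g [greg gst gc gCS]]] := gamma_exists Omega_circular a01 st0 st1 sE ED fold_upE.
have [gcos gsin] := gamma_cos_sin Omega_circular a01 st0 st1 gst gCS.
have uniq := gamma_unique Omega_circular a01 st0 st1 sE ED fold_upE gst gc gCS.
exists gamma; split=> //.
- move=> sl gamma' /(slice_regular_stem Omega_circular)[F0 [F1 [C0 C1 sy cr st]]] cg' sg'.
  have cD : connected (plane_of Omega).
    by rewrite -(Eslice sl); have [[_ _ c] _ _] := sE.
  have rl := slice_regular_scalar Omega_circular st0 st1 cD C0 C1 sy st cg' sg' sl.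
  have rs := real_stem_of_scalar Omega_circular C0 C1 sy cr st rl.
  apply: (uniq _ _ _ _ _ cg' sg') => z /ED Dz; first exact: (stem_val rs Dz).
  exact: rC1_continuous (plane_open Omega_circular) (stem_C1 rs).1 _ Dz.
- move=> _ gamma' /(slice_preserving_stem Omega_circular)[p [r rs]] cg' sg'.
  apply: (uniq _ _ _ _ _ cg' sg') => z /ED Dz; first exact: (stem_val rs Dz).
  exact: rC1_continuous (plane_open Omega_circular) (stem_C1 rs).1 _ Dz.
Qed.
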